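(* Let $F>0$, let $1<K<N$ be integers, $\varepsilon=1/N$, and let $y_F$ be the uniform circular configuration of $N$ atoms with nearest neighbor interatomic spacing $F\varepsilon$. Given $f\in\mathcal U$, let $u^{\mathrm a},u^{\mathrm{QNL}}\in\mathcal U$ satisfy $$\delta\mathcal E^{\mathrm a}(y_F)[v]+\delta^2\mathcal E^{\mathrm a}(y_F)[u^{\mathrm a},v]=\langle f,v\rangle\quad\text{and}\quad\delta\mathcal E^{\mathrm{QNL}}(y_F)[v]+\delta^2\mathcal E^{\mathrm{QNL}}(y_F)[u^{\mathrm{QNL}},v]=\langle f,v\rangle$$ for all $v\in\mathcal U$. Put $$\gamma_4=\min\left\{\phi''(F)+4\,\phi''(2F),\ \frac{\phi'(F)}{F}\right\},\qquad\gamma_\varepsilon=\gamma_4-\varepsilon\max\left\{2\pi|\phi''(2F)|+2\varepsilon C_\phi,\ 4\varepsilon(\pi^2|\phi''(2F)|+C_\phi)\right\}.$$ If $\phi\in C^3(0,\infty)$, $\phi'(2F)\ge0$, $\phi''(2F)\le0$, and if $\gamma_4>0$ and $\varepsilon$ is small enough so that $\gamma_\varepsilon>0$, then $$\begin{aligned}\|(u^{\mathrm a}-u^{\mathrm{QNL}})'\|_{\ell^2_\varepsilon}\le{}&\gamma_\varepsilon^{-1}(C_1\varepsilon^2+C_2\varepsilon^4)\left[\left(\varepsilon\sum_{\ell=K+2}^N\|(u^{\mathrm a})'_\ell\|^2\right)^{1/2}+\left(\varepsilon\sum_{\ell=K+2}^N\|(u^{\mathrm a})''_\ell\|^2\right)^{1/2}+\left(\varepsilon\sum_{\ell=K+2}^N\|(u^{\mathrm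 a})'''_{\ell+1}\|^2\right)^{1/2}\right]\\&+\gamma_\varepsilon^{-1}(C_3\varepsilon+6C_\phi\varepsilon^2+C_\phi\varepsilon^3)\left[\left(\varepsilon\|(u^{\mathrm a})'_1\|^2+\varepsilon\|(u^{\mathrm a})'_{K+1}\|^2\right)^{1/2}+\left(\varepsilon\|(u^{\mathrm a})''_1\|^2+\varepsilon\|(u^{\mathrm a})''_{K+2}\|^2\right)^{1/2}\right]\\&+\gamma_\varepsilon^{-1}(C_\kappa\varepsilon^2+C_{\mathfrak I}\varepsilon^{3/2}),\end{aligned}$$ where $$C_1=\max\left\{|\phi''(2F)|,\ \left|\tfrac{\phi'(2F)}{2F}\right|,\ 4\pi^2\left|\phi''(2F)-\tfrac{\phi'(2F)}{2F}\right|+12\,C_\phi\right\},\quad C_2=4\pi C_\phi,$$ $$C_3=\max\left\{|\phi''(2F)|,\ \left|\tfrac{\phi'(2F)}{2F}\right|,\ 2\pi\left|\phi''(2F)-\tfrac{\phi'(2F)}{2F}\right|\right\},$$ $$C_\kappa=4\,C_\phi(1+\pi^2\varepsilon^2)F+2\pi^2|\phi'(2F)|,\quad C_{\mathfrak I}=\sqrt2\left(2\varepsilon C_\phi(1+\pi\varepsilon)F+\pi|\phi'(2F)|\right).$$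
   Context: Let $\varepsilon=1/N$. $\mathcal Y$ is the set of sequences $y=\{y_\ell\}_{\ell\in\mathbb Z}$, $y_\ell\in\mathbb R^2$, with $y_{\ell+N}=y_\ell+(y_N-y_0)$ for all $\ell$. $\mathcal U$ is the set of $N$-periodic sequences $u$ in $\mathbb R^2$ with $\sum_{\ell=1}^N u_\ell=0$. Backward differences: $y'_\ell=(y_\ell-y_{\ell-1})/\varepsilon$, $y^{(n)}_\ell=(y^{(n-1)}_\ell-y^{(n-1)}_{\ell-1})/\varepsilon$. $\|\cdot\|$ is the Euclidean norm; $\langle v,w\rangle=\varepsilon\sum_{\ell=1}^N v_\ell\cdot w_\ell$, $\|v\|_{\ell^2_\varepsilon}=\langle v,v\rangle^{1/2}$. $\phi:(0,\infty)\to\mathbb R$ is the pair potential. Energies: $\mathcal E^{\mathrm a}(y)=\varepsilon\sum_{\ell=1}^N[\phi(\|y'_\ell\|)+\phi(\|y'_{\ell+1}+y'_\ell\|)]$ and $$\mathcal E^{\mathrm{QNL}}(y)=\varepsilon\sum_{\ell=1}^N\phi(\|y'_\ell\|)+\varepsilon\sum_{\ell=1}^K\phi(\|y'_{\ell+1}+y'_\ell\|)+\varepsilon\sum_{\ell=K+1}^N\tfrac12\left(\phi(2\|y'_\ell\|)+\phi(2\|y'_{\ell+1}\|)\right).$$ First and second variations: $\delta\mathcal E(y)[u]=\frac{d}{dt}\mathcal E(y+tu)|_{t=0}$, $\delta^2\mathcal E(y)[u,v]=\frac{\partial^2}{\partial s\partial t}\mathcal E(y+su+tv)|_{s=t=0}$.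 The uniform circular configuration is $(y_F)_\ell=R(\cos(2\pi\varepsilon\ell),\sin(2\pi\varepsilon\ell))$ with $F\varepsilon=2R\sin(\pi\varepsilon)$ (up to rigid motions). With $F_2=F\cos(\pi\varepsilon)$, $C_\phi>0$ denotes a constant, independent of $\varepsilon$, such that $\max\left\{|\phi''(2F_2)-\phi''(2F)|,\ \left|\frac{\phi'(2F_2)}{2F_2}-\frac{\phi'(2F)}{2F}\right|\right\}\le C_\phi\varepsilon^2$. *)

(* Defs.v *)
From HB Require Import structures.
From mathcomp Require Import all_boot all_order all_algebra.
From mathcomp Require Import all_classical all_reals all_analysis.

Set Implicit Arguments.
Unset Strict Implicit.
Unset Printing Implicit Defensive.

Import Order.TTheory GRing.Theory Num.Theory.
Import numFieldNormedType.Exports.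

Local Open Scope classical_set_scope.
Local Open Scope ring_scope.

(* The library norm on matrices is the sup norm, so the Euclidean structure of
   the plane is introduced separately. *)
Definition dot (R : realType) (v w : 'rV[R]_2) : R := \sum_(i < 2) v 0 i * w 0 i.

Definition enorm (R : realType) (v : 'rV[R]_2) : R := Num.sqrt (dot v v).

Definition eps (R : realType) (N : nat) : R := N%:R^-1.

(* Backward difference quotient: y^(n) is [iter n (bdiff N) y]. *)
Definition bdiff (R : realType) (N : nat) (y : int -> 'rV[R]_2) :
    int -> 'rV[R]_2 :=
  fun l => (eps R N)^-1 *: (y l - y (l - 1)).

(* The sets \mathcal Y (uniform deformation plus periodic) and \mathcal U
   (periodic, mean zero). *)
Definition in_Y (R : realType) (N : nat) (y : int -> 'rV[R]_2) : Prop :=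
  forall l : int, y (l + N%:Z) = y l + (y N%:Z - y 0).

Definition in_U (R : realType) (N : nat) (u : int -> 'rV[R]_2) : Prop :=
  (forall l : int, u (l + N%:Z) = u l) /\
  \sum_(1 <= l < N.+1) u l%:Z = 0.

Definition inner (R : realType) (N : nat) (v w : int -> 'rV[R]_2) : R :=
  eps R N * \sum_(1 <= l < N.+1) dot (v l%:Z) (w l%:Z).

Definition l2norm (R : realType) (N : nat) (v : int -> 'rV[R]_2) : R :=
  Num.sqrt (inner N v v).

(* A potential on (0, +oo) is represented by a function on R whose values
   outside (0, +oo) are irrelevant. *)
Definition C3_pos (R : realType) (phi : R -> R) : Prop :=
  (forall (k : nat) (x : R), (k < 3)%N -> 0 < x -> derivable (derive1n k phi) x 1) /\
  (forall x : R, 0 < x -> {for x, continuous (derive1n 3 phi)}).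

Definition E_a (R : realType) (phi : R -> R) (N : nat)
    (y : int -> 'rV[R]_2) : R :=
  let dy := bdiff N y in
  eps R N * \sum_(1 <= l < N.+1)
    (phi (enorm (dy l%:Z)) + phi (enorm (dy (l%:Z + 1) + dy l%:Z))).

Definition E_qnl (R : realType) (phi : R -> R) (N K : nat)
    (y : int -> 'rV[R]_2) : R :=
  let dy := bdiff N y in
  eps R N * (\sum_(1 <= l < N.+1) phi (enorm (dy l%:Z)))
  + eps R N * (\sum_(1 <= l < K.+1) phi (enorm (dy (l%:Z + 1) + dy l%:Z)))
  + eps R N * (\sum_(K.+1 <= l < N.+1)
      2^-1 * (phi (2 * enorm (dy l%:Z)) + phi (2 * enorm (dy (l%:Z + 1))))).

Definition variation1 (R : realType) (E : (int -> 'rV[R]_2) -> R)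
    (y u : int -> 'rV[R]_2) : R :=
  derive1 (fun t : R => E (fun l => y l + t *: u l)) 0.

Definition variation2 (R : realType) (E : (int -> 'rV[R]_2) -> R)
    (y u v : int -> 'rV[R]_2) : R :=
  derive1 (fun s : R =>
    derive1 (fun t : R => E (fun l => y l + s *: u l + t *: v l)) 0) 0.

Definition circle_pt (R : realType) (r theta : R) : 'rV[R]_2 :=
  \row_(i < 2) (if i == 0 then r * cos theta else r * sin theta).

(* Uniform circular configuration with nearest neighbour spacing F * eps,
   taken up to the rigid motions x |-> x Q + c of the plane, Q orthogonal. *)
Definition circular_config (R : realType) (F : R) (N : nat)
    (y : int -> 'rV[R]_2) : Prop :=
  exists (r : R) (Q : 'M[R]_2) (c : 'rV[R]_2),
    [/\ F * eps R N = 2 * r * sin (pi * eps R N),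
        Q *m Q^T = 1%:M
      & forall l : int,
          y l = circle_pt r (2 * pi * eps R N * l%:~R) *m Q + c].

Lemma circular_config_in_Y (R : realType) (F : R) (N : nat)
    (y : int -> 'rV[R]_2) :
  (0 < N)%N -> circular_config F N y -> in_Y N y.
Proof.
move=> N0 [r [Q [c [_ _ yE]]]].
have ang (l : int) : 2 * pi * eps R N * (l + N%:Z)%:~R
    = 2 * pi * eps R N * l%:~R + pi *+ 2.
  rewrite intrD mulrDr; congr (_ + _).
  rewrite /eps -mulrA [(N%:Z)%:~R]/(N%:R : R) mulVf ?pnatr_eq0 -?lt0n //.
  by rewrite mulr1 mulr_natl.
have per (l : int) : y (l + N%:Z) = y l.
  by rewrite !yE ang /circle_pt cosD2pi sinD2pi.
by move=> l; rewrite per -[N%:Z]add0r per subrr addr0.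
Qed.

(* Main.v *)
(** In the tangent-normal frames [T l, V l] of the circle the Hessian of a bond
is diagonal, and the direction of a next-nearest-neighbour bond is the frame at
either end rotated by half the turning angle, [pi * eps], with cosine [c] and
sine [s].

Coercivity with constant [gammae]: the tangential square of a nonlocal bond,
with components [p, q] at its two ends, is at most
[2 c^2 (p0^2 + p1^2) + 2 s^2 (q0^2 + q1^2) - 4 c s (p1 q1 - p0 q0)]; the cross
term telescopes, so it costs something only at the two interface atoms
[1] and [K + 1], where it is controlled by a reflection of norm one.

Consistency: testing the difference of the two equations with [v = ua - uq]
gives the second variation of the quasi-nonlocal energy at [v, v]; collecting the
defect atom by atom, only the local region [K + 1 .. N + 1] contributes.  An atom
with local bonds on both sides has a residual of order [eps^2], by symmetry; the two
interface atoms have residuals of order [eps], but their total weight is [eps].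
Cauchy-Schwarz then bounds the defect by the norm of [v']. *)

Require Import Defs.
From HB Require Import structures.
From mathcomp Require Import all_boot all_order all_algebra.
From mathcomp Require Import all_classical all_reals all_analysis.
From mathcomp Require Import ring lra.

Set Implicit Arguments.
Unset Strict Implicit.
Unset Printing Implicit Defensive.

Import Order.TTheory GRing.Theory Num.Theory.
Import numFieldNormedType.Exports.

Local Open Scope classical_set_scope.
Local Open Scope ring_scope.

(** * Euclidean plane geometry in orthonormal frames *)

Section Plane.
Variable R : realType.
Implicit Types x y z T V : 'rV[R]_2.

Lemma dotE x y : dot x y = x 0 0 * y 0 0 + x 0 1 * y 0 1.
Proof. by rewrite /dot !big_ord_recl big_ord0 addr0; congr (_ + x 0 _ * y 0 _); apply/val_inj. Qed.

Lemma dot_mulmx x y : dot x y = (x *m y^T) 0 0.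
Proof. by rewrite mxE; apply: eq_bigr => i _; rewrite mxE. Qed.

Lemma dotC x y : dot x y = dot y x.
Proof. by rewrite !dotE; ring. Qed.

Lemma dotDl x y z : dot (x + y) z = dot x z + dot y z.
Proof. by rewrite !dotE !mxE; ring. Qed.

Lemma dotZl (k : R) x z : dot (k *: x) z = k * dot x z.
Proof. by rewrite !dotE !mxE; ring. Qed.

Lemma dotDr x y z : dot z (x + y) = dot z x + dot z y.
Proof. by rewrite dotC dotDl !(dotC z). Qed.

Lemma dotZr (k : R) x z : dot z (k *: x) = k * dot z x.
Proof. by rewrite dotC dotZl (dotC z). Qed.

Lemma dotBr x y z : dot z (x - y) = dot z x - dot z y.
Proof. by rewrite -scaleN1r dotDr dotZr mulN1r. Qed.

Lemma dotBl x y z : dot (x - y) z = dot x z - dot y z.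
Proof. by rewrite dotC dotBr !(dotC z). Qed.

Lemma dotxx_ge0 x : 0 <= dot x x.
Proof. by rewrite dotE -!expr2 addr_ge0 ?sqr_ge0. Qed.

Lemma enorm_ge0 x : 0 <= enorm x. Proof. exact: sqrtr_ge0. Qed.

Lemma sqr_enorm x : enorm x ^+ 2 = dot x x.
Proof. by rewrite sqr_sqrtr ?dotxx_ge0. Qed.

Lemma enormZ (k : R) x : enorm (k *: x) = `|k| * enorm x.
Proof. by rewrite /enorm dotZl dotZr mulrA -expr2 sqrtrM ?sqr_ge0// sqrtr_sqr. Qed.

Lemma enormN x : enorm (- x) = enorm x.
Proof. by rewrite -scaleN1r enormZ normrN1 mul1r. Qed.

Definition orthoframe T V := [/\ dot T T = 1, dot V V = 1 & dot T V = 0].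

(** Parseval: the matrix [M] with rows [T], [V] satisfies [M *m M^T = 1], and for a square matrix
    this gives [M^T *m M = 1], which is inserted between [x] and [y]. *)
Lemma dot_frame T V x y : orthoframe T V ->
  dot x y = dot T x * dot T y + dot V x * dot V y.
Proof.
case=> TT VV TV.
pose M : 'M[R]_2 := \matrix_(i < 2) (if i == 0 then T else V).
have rM i : row i M = if i == 0 then T else V by rewrite rowK.
have MM : M *m M^T = 1%:M.
  apply/matrixP => i j; rewrite !mxE.
  transitivity (dot (row i M) (row j M)).
    by apply: eq_bigr => k _; rewrite !mxE.
  rewrite !rM.
  by case: i j => [[|[|//]] ?] [[|[|//]] ?] /=; rewrite ?TT ?VV ?TV// dotC TV.
have MM' := mulmx1C MM.
rewrite dot_mulmx -{1}[x]mulmx1 -MM' mulmxA -mulmxA mxE !big_ord_recl big_ord0.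
have E z : forall i, (z *m M^T) 0 i = dot (row i M) z.
  by move=> i; rewrite mxE; apply: eq_bigr => k _; rewrite !mxE mulrC.
have E' z : forall i, (M *m z^T) i 0 = dot (row i M) z.
  by move=> i; rewrite mxE; apply: eq_bigr => k _; rewrite !mxE.
by rewrite addr0 !E !E' !rM.
Qed.

Lemma orthoframe_rot c s T V : c ^+ 2 + s ^+ 2 = 1 -> orthoframe T V ->
  orthoframe (c *: T + s *: V) (c *: V - s *: T).
Proof.
move=> cs1 [TT VV TV].
split; rewrite !(dotBl, dotBr, dotDl, dotDr, dotZl, dotZr) (dotC V T) TT VV TV.
- by rewrite -[RHS]cs1; ring.
- by rewrite -[RHS]cs1; ring.
- by ring.
Qed.

End Plane.

(** * First and second variations of a single pair interaction *)

Section Variations.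
Variable R : realType.
Implicit Types A B U T V : 'rV[R]_2.

Lemma is_derive_dot_line A B C (t : R) :
  is_derive t 1 (fun t => dot (A + t *: B) C) (dot B C).
Proof.
have -> : (fun t => dot (A + t *: B) C) = (fun t => dot A C + dot B C * t).
  by apply/funext => u; rewrite dotDl dotZl mulrC.
have h := is_deriveD (is_derive_cst (dot A C) t 1) (is_deriveZ (dot B C) (is_derive_id t 1)).
by apply: is_derive_eq h _; rewrite add0r /GRing.scale /= mulr1.
Qed.

Lemma is_derive_enorm_line A B (t : R) : 0 < enorm (A + t *: B) ->
  is_derive t 1 (fun t => enorm (A + t *: B))
    (dot (A + t *: B) B / enorm (A + t *: B)).
Proof.
move=> n0.
have q0 : 0 < dot (A + t *: B) (A + t *: B) by rewrite -sqr_enorm exprn_gt0.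
have h : is_derive t 1 (fun t => dot (A + t *: B) (A + t *: B))
    (2 * dot (A + t *: B) B).
  have -> : (fun t => dot (A + t *: B) (A + t *: B)) =
     (fun t => dot A (A + t *: B)) + (@id R) * (fun t => dot (A + t *: B) B).
    by apply/funext => u; rewrite /= {1}dotDl dotZl (dotC B).
  have h1 : is_derive t 1 (fun t => dot A (A + t *: B)) (dot A B).
    under eq_fun do rewrite dotC; rewrite dotC; exact: is_derive_dot_line.
  have h2 := is_derive_dot_line A B B t.
  have h3 := is_deriveD h1 (is_deriveM (is_derive_id t 1) h2).
  by apply: is_derive_eq h3 _; rewrite /GRing.scale /= mulr1 !dotDl !dotZl; ring.
have := @is_derive1_comp _ (@Num.sqrt R) (fun t => dot (A + t *: B) (A + t *: B)) t _ _
  (is_derive1_sqrt q0) h.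
move=> k; apply: is_derive_eq k _.
by rewrite -[Num.sqrt _]/(enorm _); field; rewrite gt_eqF.
Qed.

Lemma continuous_enorm_line A B (t : R) : 0 < enorm (A + t *: B) ->
  \forall s \near t, 0 < enorm (A + s *: B).
Proof.
move=> n0; have [/derivable1_diffP/differentiable_continuous c _] := is_derive_enorm_line n0.
move: c => /cvgr_gt c; exact: c n0.
Qed.

Variable phi : R -> R.

Lemma is_derive_pair_potential A B (t : R) : 0 < enorm (A + t *: B) ->
  derivable phi (enorm (A + t *: B)) 1 ->
  is_derive t 1 (fun t => phi (enorm (A + t *: B)))
    (derive1 phi (enorm (A + t *: B)) * (dot (A + t *: B) B / enorm (A + t *: B))).
Proof.
move=> n0 /derivableP dphi; have := is_derive_enorm_line n0.
by rewrite derive1E; apply: is_derive1_comp.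
Qed.

(* [Psi s t] stands for [E (y + s u + t v)]: [d1] and [d2] are the values of
   the first variation in the direction [v] and of the second in [(u, v)]. *)
Definition has_variations (Psi : R -> R -> R) (d1 d2 : R) : Prop :=
  exists g : R -> R, [/\ \forall s \near (0 : R), is_derive (0 : R) 1 (Psi s) (g s),
    g 0 = d1 & is_derive (0 : R) 1 g d2].

(** The inner derivative is known only for [s] near 0, because a bond length must stay positive; the
    outer derivative at 0 sees no more than that neighbourhood. *)
Lemma has_variations_derive1 Psi d1 d2 : has_variations Psi d1 d2 ->
  derive1 (Psi 0) 0 = d1 /\ derive1 (fun s => derive1 (Psi s) 0) 0 = d2.
Proof.
case=> g [dPsi g0 dg]; split.
  by rewrite derive1E; have [_ ->] := nbhs_singleton dPsi.
rewrite derive1E; have -> : 'D_1 (fun s => derive1 (Psi s) 0) 0 = 'D_1 g 0; last by case: dg.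
apply: near_eq_derive; near=> s.
rewrite derive1E; have [_ ->//] : is_derive (0 : R) 1 (Psi s) (g s).
by near: s.
Unshelve. all: by end_near. Qed.

Lemma has_variationsD Psi1 Psi2 d1 d2 d1' d2' :
  has_variations Psi1 d1 d2 -> has_variations Psi2 d1' d2' ->
  has_variations (fun s t => Psi1 s t + Psi2 s t) (d1 + d1') (d2 + d2').
Proof.
move=> [g [dg g0 g']] [h [dh h0 h']]; exists (g + h); split; first last.
- exact: is_deriveD.
- by rewrite -g0 -h0.
by near=> s; apply: is_deriveD; near: s.
Unshelve. all: by end_near. Qed.

Lemma has_variationsZ Psi (k : R) d1 d2 :
  has_variations Psi d1 d2 ->
  has_variations (fun s t => k * Psi s t) (k * d1) (k * d2).
Proof.
move=> [g [dg g0 g']]; exists (k \*: g); split; first last.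
- exact: is_deriveZ.
- by rewrite -g0.
by near=> s; apply: is_deriveZ; near: s.
Unshelve. all: by end_near. Qed.

Lemma has_variations_sum (I : Type) (r : seq I) (Psi : I -> R -> R -> R) d1 d2 :
  (forall i, has_variations (Psi i) (d1 i) (d2 i)) ->
  has_variations (fun s t => \sum_(i <- r) Psi i s t)
    (\sum_(i <- r) d1 i) (\sum_(i <- r) d2 i).
Proof.
move=> dPsi; elim: r => [|i r IH].
  rewrite !big_nil; exists (cst 0); split => //; last exact: is_derive_cst.
  by near=> s; under eq_fun do rewrite big_nil; exact: is_derive_cst.
rewrite !big_cons; under eq_fun do under eq_fun do rewrite big_cons.
exact: has_variationsD.
Unshelve. all: by end_near. Qed.

(** With [a] the second derivative of the potential and [b] its first derivative divided by the
    length, this is the Hessian of the pair energy of a bond along [T]. *)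
Definition qform (a b : R) T V (x y : 'rV[R]_2) :=
  a * (dot T x * dot T y) + b * (dot V x * dot V y).

Hypothesis C3phi : C3_pos phi.

(** Differentiating [1 / n] removes the tangential part of [dot U B / r]. So [phi' / r] acts on
    normal components only, and [phi''] on tangential ones. *)
Lemma has_variations_pair (r : R) T V U B : 0 < r -> orthoframe T V ->
  has_variations (fun s t => phi (enorm (r *: T + s *: U + t *: B)))
    (derive1 phi r * dot T B)
    (qform (derive1n 2 phi r) (derive1 phi r / r) T V U B).
Proof.
move=> r0 TV; have [TT _ _] := TV.
have dphi (x : R) : 0 < x -> derivable phi x 1 by exact: (C3phi.1 0%N).
have ddphi (x : R) : 0 < x -> is_derive x 1 (derive1 phi) (derive1n 2 phi x).
  by move=> x0; have /derivableP := C3phi.1 1%N x isT x0; rewrite -derive1E.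
pose n s := enorm (r *: T + s *: U).
have n0 : n 0 = r.
  by rewrite /n scale0r addr0 enormZ /enorm TT sqrtr1 mulr1 gtr0_norm.
exists ((derive1 phi \o n) * ((fun s => dot (r *: T + s *: U) B) * (fun s => (n s)^-1))).
split.
- have npos : \forall s \near 0, 0 < n s.
    by apply: continuous_enorm_line; rewrite -/(n 0) n0.
  near=> s; have ns : 0 < n s by near: s.
  have := @is_derive_pair_potential (r *: T + s *: U) B 0.
  by rewrite scale0r addr0; apply=> //; exact: dphi.
- rewrite -[LHS]/(derive1 phi (n 0) * (dot (r *: T + 0 *: U) B * (n 0)^-1)).
  by rewrite n0 scale0r addr0 dotZl; field; rewrite gt_eqF.
- have dn : is_derive (0 : R) 1 n (dot T U).
    have := @is_derive_enorm_line (r *: T) U 0.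
    rewrite -/(n 0) n0 scale0r addr0 dotZl => /(_ r0) h.
    by apply: is_derive_eq h _; field; rewrite gt_eqF.
  have dn' : is_derive (0 : R) 1 (fun s => (n s)^-1) (- r ^- 2 * dot T U).
    have nn0 : n 0 != 0 by rewrite n0 gt_eqF.
    by have := is_deriveV nn0 dn; rewrite n0.
  have d1 : is_derive (0 : R) 1 (derive1 phi \o n) (derive1n 2 phi r * dot T U).
    by apply: is_derive1_comp; rewrite n0; exact: ddphi.
  have d2 := is_derive_dot_line (r *: T) U B 0.
  apply: is_derive_eq (is_deriveM d1 (is_deriveM d2 dn')) _.
  rewrite -[((fun _ => _) * (fun _ => _)) _]/(dot (r *: T + 0 *: U) B * (n 0)^-1).
  rewrite -![_ *: _ in LHS]/(_ * _) -[(n 0)^-1 *: _]/((n 0)^-1 * _) /= n0 scale0r addr0.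
  rewrite dotZl (dot_frame U B TV) /qform -[_ *: _]/(_ * _).
  by field; rewrite gt_eqF.
Unshelve. all: by end_near. Qed.
End Variations.

(** * Cauchy-Schwarz inequalities and bounds on quadratic forms *)

Section Forms.
Variable R : realType.

Lemma cauchy_schwarz2 (x0 x1 y0 y1 : R) :
  `|x0 * y0 + x1 * y1|
    <= Num.sqrt (x0 ^+ 2 + x1 ^+ 2) * Num.sqrt (y0 ^+ 2 + y1 ^+ 2).
Proof.
rewrite -sqrtrM ?addr_ge0 ?sqr_ge0// -sqrtr_sqr ler_wsqrtr//.
(* Lagrange's identity: the gap between the two squared sides is exactly this square. *)
by rewrite -subr_ge0; apply: le_trans (sqr_ge0 (x0 * y1 - x1 * y0)) _; lra.
Qed.

(** Induction on [r]: the norms of the tails serve as second components in the two-term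
    inequality. *)
Lemma cauchy_schwarz_sum (I : Type) (r : seq I) (f g : I -> R) :
  \sum_(i <- r) f i * g i
    <= Num.sqrt (\sum_(i <- r) f i ^+ 2) * Num.sqrt (\sum_(i <- r) g i ^+ 2).
Proof.
elim: r => [|i r IH]; first by rewrite !big_nil sqrtr0 mulr0.
rewrite !big_cons.
have sq (h : I -> R) : \sum_(j <- r) h j ^+ 2 = Num.sqrt (\sum_(j <- r) h j ^+ 2) ^+ 2.
  by rewrite sqr_sqrtr// sumr_ge0// => j _; exact: sqr_ge0.
rewrite (sq f) (sq g); apply: le_trans (lerD (lexx _) IH) _.
exact: le_trans (ler_norm _) (cauchy_schwarz2 _ _ _ _).
Qed.

Lemma cauchy_schwarz_weighted (I : Type) (r : seq I) (f g : I -> R) (e : R) :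
  0 <= e ->
  e * \sum_(i <- r) f i * g i <= Num.sqrt (e * \sum_(i <- r) f i ^+ 2)
    * Num.sqrt (e * \sum_(i <- r) g i ^+ 2).
Proof.
move=> e0; rewrite !sqrtrM// mulrACA -expr2 sqr_sqrtr// ler_wpM2l//.
exact: cauchy_schwarz_sum.
Qed.

Implicit Types T V x y u v w z : 'rV[R]_2.

Lemma enorm_frame T V x : orthoframe T V ->
  enorm x = Num.sqrt (dot T x ^+ 2 + dot V x ^+ 2).
Proof. by move=> TV; rewrite /enorm (dot_frame _ _ TV). Qed.

Lemma dot_le x y : `|dot x y| <= enorm x * enorm y.
Proof.
have E z : enorm z = Num.sqrt (z 0 0 ^+ 2 + z 0 1 ^+ 2).
  by rewrite /enorm dotE.
rewrite dotE !E; exact: cauchy_schwarz2.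
Qed.

Lemma qform_le a b (M : R) T V x y : orthoframe T V -> `|a| <= M -> `|b| <= M ->
  `|qform a b T V x y| <= M * (enorm x * enorm y).
Proof.
move=> TV aM bM; have M0 := le_trans (normr_ge0 _) aM.
rewrite !(enorm_frame _ TV) /qform.
have := cauchy_schwarz2 `|dot T x| `|dot V x| `|dot T y| `|dot V y|.
rewrite !real_normK ?num_real// => /(le_trans (ler_norm _)) /(ler_wpM2l M0); apply: le_trans.
rewrite mulrDr; apply: le_trans (ler_normD _ _) _.
by rewrite !normrM; apply: lerD; rewrite ler_wpM2r ?mulr_ge0.
Qed.

(** In frame coordinates the form has the matrix with rows [(s, -c)] and [(-c, -s)], a reflection,
    so applying it to [x] preserves the norm. *)
Lemma reflection_le c s T V x y : orthoframe T V -> c ^+ 2 + s ^+ 2 = 1 ->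
  `|s * (dot T x * dot T y - dot V x * dot V y)
    - c * (dot T x * dot V y + dot V x * dot T y)| <= enorm x * enorm y.
Proof.
move=> TV cs1; rewrite !(enorm_frame _ TV).
set x0 := dot T x; set x1 := dot V x; set y0 := dot T y; set y1 := dot V y.
have -> : s * (x0 * y0 - x1 * y1) - c * (x0 * y1 + x1 * y0) =
  (s * x0 - c * x1) * y0 + (- c * x0 - s * x1) * y1 by ring.
have -> : x0 ^+ 2 + x1 ^+ 2 = (s * x0 - c * x1) ^+ 2 + (- c * x0 - s * x1) ^+ 2.
  by rewrite -[LHS]mul1r -cs1; ring.
exact: cauchy_schwarz2.
Qed.

Lemma qformDl a b T V x x' y :
  qform a b T V (x + x') y = qform a b T V x y + qform a b T V x' y.
Proof. by rewrite /qform !dotDr; ring. Qed.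

Lemma qformDr a b T V x y y' :
  qform a b T V x (y + y') = qform a b T V x y + qform a b T V x y'.
Proof. by rewrite /qform !dotDr; ring. Qed.

Lemma qformBl a b T V x x' y :
  qform a b T V (x - x') y = qform a b T V x y - qform a b T V x' y.
Proof. by rewrite /qform !dotBr; ring. Qed.

Lemma qformZl a b T V k x y : qform a b T V (k *: x) y = k * qform a b T V x y.
Proof. by rewrite /qform !dotZr; ring. Qed.

Lemma enorm_unit T : dot T T = 1 -> enorm T = 1.
Proof. by move=> TT; rewrite /enorm TT sqrtr1. Qed.

(** * Hessian and force residuals at one atom, with rotated frames *)

Section Residuals.
Variables (a b a2 b2 eta c s : R) (T V : 'rV[R]_2).
Hypotheses (TV : orthoframe T V) (cs1 : c ^+ 2 + s ^+ 2 = 1).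
Hypotheses (a2a : `|a2 - a| <= eta) (b2b : `|b2 - b| <= eta).

Let eta0 : 0 <= eta. Proof. exact: le_trans a2a. Qed.
Let c1 : `|c| <= 1.
Proof. by rewrite -(@expr_le1 _ 2)// real_normK ?num_real// -cs1 lerDl sqr_ge0. Qed.

(** Rotating the frame of [diag(a, b)] changes the form by [s * (a - b)] times a reflection of norm
    one; replacing [a2], [b2] by [a], [b] costs [eta]. *)
Lemma hessian_jump_le u w :
  `|qform a b T V u w - qform a2 b2 (c *: T + s *: V) (c *: V - s *: T) u w|
    <= (eta + `|s| * `|a - b|) * (enorm u * enorm w).
Proof.
have -> : qform a b T V u w - qform a2 b2 (c *: T + s *: V) (c *: V - s *: T) u w =
   - qform (a2 - a) (b2 - b) (c *: T + s *: V) (c *: V - s *: T) u w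
   + s * (a - b) * (s * (dot T u * dot T w - dot V u * dot V w)
    - c * (dot T u * dot V w + dot V u * dot T w)).
  by rewrite -[qform a b T V u w]mul1r -cs1 /qform !(dotBl, dotDl, dotZl); ring.
apply: le_trans (ler_normD _ _) _; rewrite normrN mulrDl.
apply: lerD; first exact: qform_le (orthoframe_rot cs1 TV) a2a b2b.
by rewrite !normrM ler_wpM2l// ?mulr_ge0//; exact: reflection_le.
Qed.

Lemma qform_rot_le (M : R) x y : `|a| <= M -> `|b| <= M ->
  `|qform a2 b2 (c *: T + s *: V) (c *: V - s *: T) x y| <= (M + eta) * (enorm x * enorm y).
Proof.
move=> aM bM; apply: qform_le (orthoframe_rot cs1 TV) _ _.
  by rewrite -[a2](subrK a) addrC; apply: le_trans (ler_normD _ _) (lerD _ _).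
by rewrite -[b2](subrK b) addrC; apply: le_trans (ler_normD _ _) (lerD _ _).
Qed.

(* Residual of the Hessians at an atom with one local and one nonlocal bond;
   [w] is the test function, [u] and [e v] the strain and its increment. *)
Lemma boundary_residual_le (M e : R) u v w : 0 <= e -> `|a| <= M -> `|b| <= M ->
  `|2 * qform a b T V u w
    - qform a2 b2 (c *: T + s *: V) (c *: V - s *: T) (2 *: u + e *: v) w|
  <= 2 * (eta + `|s| * `|a - b|) * (enorm u * enorm w)
     + e * (M + eta) * (enorm v * enorm w).
Proof.
move=> e0 aM bM; rewrite qformDl !qformZl opprD addrA -mulrBr.
apply: le_trans (ler_normB _ _) _.
rewrite !normrM (@ger0_norm _ 2)// (ger0_norm e0) -!mulrA.
apply: lerD; rewrite ler_wpM2l//; first exact: hessian_jump_le.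
exact: qform_rot_le.
Qed.

(** The two nonlocal bonds are rotated by opposite angles, so on [u] their off-diagonal parts,
    linear in [s], cancel and only [s ^+ 2] remains. On [e *: v] the off-diagonal parts add up,
    giving order [e * s]; the remaining increment has order [e ^+ 2]. *)
Lemma interior_residual_le (M e : R) u v z w : 0 <= e -> `|a| <= M -> `|b| <= M ->
  `|4 * qform a b T V u w
    - qform a2 b2 (c *: T + s *: V) (c *: V - s *: T) (2 *: u + e *: (v + e *: z)) w
    - qform a2 b2 (c *: T - s *: V) (c *: V + s *: T) (2 *: u - e *: v) w|
  <= 4 * (eta + s ^+ 2 * `|a - b|) * (enorm u * enorm w)
     + 2 * e * `|s| * (`|a - b| + 2 * eta) * (enorm v * enorm w)
     + e ^+ 2 * (M + eta) * (enorm z * enorm w).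
Proof.
move=> e0 aM bM.
(* The mean of the two rotated Hessians is diagonal in the frame [T, V]; [al] and [be] are what is
   left of [a] and [b] after subtracting it. *)
pose al := a - c ^+ 2 * a2 - s ^+ 2 * b2.
pose be := b - c ^+ 2 * b2 - s ^+ 2 * a2.
have c2 : 0 <= c ^+ 2 by exact: sqr_ge0.
have s2 : 0 <= s ^+ 2 by exact: sqr_ge0.
have alE : al = c ^+ 2 * (a - a2) + s ^+ 2 * (b - b2) + s ^+ 2 * (a - b).
  by rewrite /al -{1}[a]mul1r -cs1; ring.
have beE : be = c ^+ 2 * (b - b2) + s ^+ 2 * (a - a2) - s ^+ 2 * (a - b).
  by rewrite /be -{1}[b]mul1r -cs1; ring.
have tri (x y : R) : `|x| <= eta -> `|y| <= eta -> `|c ^+ 2 * x + s ^+ 2 * y| <= eta.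
  move=> xe ye; rewrite -[eta]mul1r -cs1 mulrDl; apply: le_trans (ler_normD _ _) _.
  by rewrite (normrM _ x) (normrM _ y) (ger0_norm c2) (ger0_norm s2); apply: lerD; apply: ler_wpM2l.
have alle : `|al| <= eta + s ^+ 2 * `|a - b|.
  rewrite alE; apply: le_trans (ler_normD _ _) _; rewrite [in X in _ + X]normrM (ger0_norm s2).
  by rewrite lerD2r; apply: tri; rewrite distrC.
have bele : `|be| <= eta + s ^+ 2 * `|a - b|.
  rewrite beE; apply: le_trans (ler_normB _ _) _; rewrite [in X in _ + X]normrM (ger0_norm s2).
  by rewrite lerD2r; apply: tri; rewrite distrC.
have abl : `|a2 - b2| <= `|a - b| + 2 * eta.
  have -> : a2 - b2 = (a - b) + ((a2 - a) - (b2 - b)) by ring.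
  apply: le_trans (ler_normD _ _) _; rewrite lerD2l; apply: le_trans (ler_normB _ _) _.
  by rewrite mulr2n mulrDl mul1r lerD.
have -> : 4 * qform a b T V u w
    - qform a2 b2 (c *: T + s *: V) (c *: V - s *: T) (2 *: u + e *: (v + e *: z)) w
    - qform a2 b2 (c *: T - s *: V) (c *: V + s *: T) (2 *: u - e *: v) w =
  4 * qform al be T V u w
  + 2 * e * (- c * s * (a2 - b2)) * (dot T v * dot V w + dot V v * dot T w)
  - e ^+ 2 * qform a2 b2 (c *: T + s *: V) (c *: V - s *: T) z w.
  by rewrite /qform /al /be !(dotBl, dotDl, dotZl, dotBr, dotDr, dotZr); ring.
apply: le_trans (ler_normB _ _) _; rewrite normrM [`|e ^+ 2|]ger0_norm ?sqr_ge0//.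
apply: lerD; last by rewrite -mulrA ler_wpM2l ?sqr_ge0//; exact: qform_rot_le.
apply: le_trans (ler_normD _ _) _; apply: lerD.
  by rewrite normrM (@ger0_norm _ 4)// -mulrA ler_wpM2l//; exact: qform_le.
rewrite normrM ler_pM//.
  rewrite !normrM (@ger0_norm _ 2)// (ger0_norm e0) normrN -!mulrA !ler_wpM2l//.
  by apply: le_trans (ler_piMl _ c1) _; rewrite ?mulr_ge0// ler_wpM2l.
(* The symmetric cross term is the reflection with [c = 1], [s = 0]. *)
have := @reflection_le 1 0 T V v w TV; rewrite expr1n expr0n addr0 => /(_ erefl).
by rewrite mul0r mul1r sub0r normrN.
Qed.


(** With equal coefficients the difference is [b * s] times the unit vector [s *: T - c *: V], hence
    of first order in [s]. *)
Lemma boundary_force_le w :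
  `|b * dot T w - c * b2 * dot (c *: T + s *: V) w| <= (`|b| * `|s| + eta) * enorm w.
Proof.
have -> : b * dot T w - c * b2 * dot (c *: T + s *: V) w =
    b * s * dot (s *: T + (- c) *: V) w - c * (b2 - b) * dot (c *: T + s *: V) w.
  by rewrite -[b * dot T w]mul1r -cs1 !(dotDl, dotZl); ring.
have unit c' s' : c' ^+ 2 + s' ^+ 2 = 1 -> `|dot (c' *: T + s' *: V) w| <= enorm w.
  move=> /orthoframe_rot /(_ TV)[e1 _ _]; apply: le_trans (dot_le _ _) _.
  by rewrite enorm_unit ?mul1r.
apply: le_trans (ler_normB _ _) _; rewrite mulrDl; apply: lerD; rewrite normrM.
  by rewrite normrM ler_wpM2l ?mulr_ge0// unit// sqrrN addrC.
by rewrite ler_pM// ?unit// normrM; apply: le_trans (ler_piMl _ c1) b2b.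
Qed.

(** The two rotated directions add up to [2 * c] times [T]: the normal parts cancel and the error is
    of second order in [s]. *)
Lemma interior_force_le w :
  `|2 * b * dot T w - c * b2 * dot (c *: T + s *: V) w - c * b2 * dot (c *: T - s *: V) w|
    <= 2 * (s ^+ 2 * `|b| + eta) * enorm w.
Proof.
have -> : 2 * b * dot T w - c * b2 * dot (c *: T + s *: V) w
      - c * b2 * dot (c *: T - s *: V) w =
    2 * (s ^+ 2 * b + c ^+ 2 * (b - b2)) * dot T w.
  have bE : b = (c ^+ 2 + s ^+ 2) * b by rewrite cs1 mul1r.
  by rewrite {1}bE !(dotBl, dotDl, dotZl); ring.
rewrite normrM; apply: ler_pM => //; last first.
  by apply: le_trans (dot_le _ _) _; case: TV => TT _ _; rewrite enorm_unit ?mul1r.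
rewrite normrM (@ger0_norm _ 2)// ler_wpM2l//; apply: le_trans (ler_normD _ _) _.
rewrite (normrM _ b) (normrM _ (b - b2)) (ger0_norm (sqr_ge0 s)) (ger0_norm (sqr_ge0 c)).
rewrite lerD2l distrC.
by apply: le_trans b2b; rewrite ler_piMl// -cs1 lerDl sqr_ge0.
Qed.

End Residuals.
End Forms.

(** * Regrouping of sums over bonds into sums over atoms *)

Section Sums.

(** Bond [l] contributes [P l] at its left end and [Q l.+1] at its right end. Inner atoms collect
    both kinds, the two extreme atoms only one. *)
Lemma sum_shift (V : zmodType) (P Q : nat -> V) (m n : nat) : (m < n)%N ->
  \sum_(m <= l < n) (P l + Q l.+1)
    = P m + \sum_(m.+1 <= l < n) (P l + Q l) + Q n.
Proof.
move=> mn; have -> : \sum_(m <= l < n) (P l + Q l.+1) =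
    \sum_(m <= l < n) P l + \sum_(m.+1 <= l < n.+1) Q l.
  by rewrite big_split /= big_add1.
by rewrite big_ltn// [X in _ + X]big_nat_recr//= big_split /= !addrA.
Qed.

Lemma sum_split_interface (V : zmodType) (f : nat -> V) (K N : nat) :
  (1 <= K)%N -> (K < N)%N ->
  \sum_(1 <= l < N.+1) f l = f 1%N + \sum_(2 <= l < K.+1) f l + f K.+1
    + \sum_(K.+2 <= l < N.+1) f l.
Proof.
move=> K1 KN; rewrite (big_cat_nat (n := K.+1))//=; last exact: leqW.
by rewrite big_ltn// [X in _ + X = _]big_ltn// addrA.
Qed.

End Sums.

(** * Coercivity of the quasi-nonlocal Hessian in scalar components *)

Section Stability.
Variable R : realType.

Lemma reflection_quad_le (c s p q : R) : c ^+ 2 + s ^+ 2 = 1 ->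
  `|s * (q ^+ 2 - p ^+ 2) + 2 * c * (p * q)| <= p ^+ 2 + q ^+ 2.
Proof.
move=> cs1.
have -> : s * (q ^+ 2 - p ^+ 2) + 2 * c * (p * q) =
  (- s * p + c * q) * p + (s * q + c * p) * q by ring.
apply: le_trans (cauchy_schwarz2 _ _ _ _) _.
have -> : (- s * p + c * q) ^+ 2 + (s * q + c * p) ^+ 2 = p ^+ 2 + q ^+ 2.
  by rewrite -[RHS]mul1r -cs1; ring.
by rewrite -expr2 sqr_sqrtr// addr_ge0 ?sqr_ge0.
Qed.

Variables (A B a b a2 b2 eta c s g mu : R).
Hypotheses (a0 : a <= 0) (b0 : 0 <= b) (s0 : 0 <= s) (cs1 : c ^+ 2 + s ^+ 2 = 1).
Hypotheses (a2a : `|a2 - a| <= eta) (b2b : `|b2 - b| <= eta).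
Hypotheses (gA : g + mu <= A + 4 * a) (gB : g + mu <= B).
Hypotheses (mu1 : 2 * s * - a + 2 * eta <= mu) (mu2 : 4 * s ^+ 2 * - a + 4 * eta <= mu).

(** The share of one end in the lower bound for a nonlocal bond, without the telescoping cross
    term. *)
Let X p q : R := a * (2 * c ^+ 2 * p ^+ 2 + 2 * s ^+ 2 * q ^+ 2) - 2 * eta * (p ^+ 2 + q ^+ 2).

(* The cross term telescopes along the chain, since
   [(p1+p0)(q1-q0) + (p1-p0)(q1+q0) = 2(p1 q1 - p0 q0)]. *)
Lemma bond_stability (p0 q0 p1 q1 : R) :
  X p0 q0 + X p1 q1 - 4 * a * c * s * (p1 * q1 - p0 * q0) <=
  a2 * (c * (p1 + p0) - s * (q1 - q0)) ^+ 2 + b2 * (c * (q1 + q0) + s * (p1 - p0)) ^+ 2.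
Proof.
set S := c * (p1 + p0) - s * (q1 - q0); set M := c * (q1 + q0) + s * (p1 - p0).
(* Parallelogram identity: the bracket is [S ^+ 2] plus the square of
   [c * (p1 - p0) - s * (q1 + q0)], and [a <= 0] reverses the inequality. *)
have aS : a * (2 * c ^+ 2 * (p0 ^+ 2 + p1 ^+ 2) + 2 * s ^+ 2 * (q0 ^+ 2 + q1 ^+ 2)
    - 4 * c * s * (p1 * q1 - p0 * q0)) <= a * S ^+ 2.
  rewrite ler_wnM2l// -subr_ge0; apply: le_trans (sqr_ge0 (c * (p1 - p0) - s * (q1 + q0))) _.
  by rewrite le_eqVlt /S; apply/orP; left; apply/eqP; ring.
(* This prices the replacement of [a2], [b2] by [a], [b]: [2 * eta] at each end. *)
have SM : S ^+ 2 + M ^+ 2 <= 2 * (p0 ^+ 2 + q0 ^+ 2 + (p1 ^+ 2 + q1 ^+ 2)).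
  rewrite -subr_ge0.
  have := addr_ge0 (sqr_ge0 (c * (p1 - p0) - s * (q1 + q0)))
    (sqr_ge0 (c * (q1 - q0) + s * (p1 + p0))).
  congr (0 <= _).
  have -> (z : R) : 2 * z = (c ^+ 2 + s ^+ 2) * (2 * z) by rewrite cs1 mul1r.
  by rewrite /S /M; ring.
have [/andP[la _] /andP[lb _]] : (- eta <= a2 - a <= eta) /\ (- eta <= b2 - b <= eta).
  by rewrite -!ler_norml.
have eta0 : 0 <= eta by exact: le_trans a2a.
have h1 := ler_wpM2r (sqr_ge0 S) la; have h2 := ler_wpM2r (sqr_ge0 M) lb.
have h3 := mulr_ge0 b0 (sqr_ge0 M); have h4 := ler_wpM2l eta0 SM.
by rewrite /X; lra.
Qed.

(** After regrouping by atoms the inequality holds atom by atom. Inner nonlocal atoms lose at most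
    [4 * s ^+ 2 * - a + 4 * eta], interface atoms at most [2 * s * - a + 2 * eta], and [mu] covers
    both losses. *)
Lemma chain_stability (N K : nat) (p q : nat -> R) : (1 <= K)%N -> (K < N)%N ->
  p N.+1 = p 1%N -> q N.+1 = q 1%N ->
  g * \sum_(1 <= l < N.+1) (p l ^+ 2 + q l ^+ 2) <=
  \sum_(1 <= l < N.+1) (A * p l ^+ 2 + B * q l ^+ 2)
  + \sum_(1 <= l < K.+1) (a2 * (c * (p l.+1 + p l) - s * (q l.+1 - q l)) ^+ 2
      + b2 * (c * (q l.+1 + q l) + s * (p l.+1 - p l)) ^+ 2)
  + \sum_(K.+1 <= l < N.+1) 2 * ((a * p l ^+ 2 + b * q l ^+ 2)
      + (a * p l.+1 ^+ 2 + b * q l.+1 ^+ 2)).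
Proof.
move=> K1 KN pN qN.
have eta0 : 0 <= eta by exact: le_trans a2a.
have gA' : 0 <= A + 4 * a - g - mu by move: gA; lra.
have gB' : 0 <= B - g - mu by move: gB; lra.
have s2 := sqr_ge0 s.
have smu : 0 <= s ^+ 2 * - a by rewrite mulr_ge0 ?oppr_ge0.
pose Z l := p l * q l; pose Y l := 2 * a * p l ^+ 2.
have le1 : \sum_(1 <= l < K.+1) (X (p l) (q l) + X (p l.+1) (q l.+1))
      - 4 * a * c * s * (Z K.+1 - Z 1%N) <=
    \sum_(1 <= l < K.+1) (a2 * (c * (p l.+1 + p l) - s * (q l.+1 - q l)) ^+ 2
      + b2 * (c * (q l.+1 + q l) + s * (p l.+1 - p l)) ^+ 2).
  rewrite -telescope_sumr//.
  by rewrite mulr_sumr -sumrB; apply: ler_sum => l _; exact: bond_stability.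
have le2 : \sum_(K.+1 <= l < N.+1) (Y l + Y l.+1) <=
    \sum_(K.+1 <= l < N.+1) 2 * ((a * p l ^+ 2 + b * q l ^+ 2)
      + (a * p l.+1 ^+ 2 + b * q l.+1 ^+ 2)).
  apply: ler_sum => l _; rewrite /Y.
  have h1 := mulr_ge0 b0 (sqr_ge0 (q l)); have h2 := mulr_ge0 b0 (sqr_ge0 (q l.+1)).
  by lra.
apply: le_trans (lerD (lerD (lexx _) le1) le2).
rewrite (sum_shift (fun l => X (p l) (q l)) (fun l => X (p l) (q l)))//.
rewrite (sum_shift Y Y)// !(sum_split_interface _ K1 KN).
set V := fun l => A * p l ^+ 2 + B * q l ^+ 2.
have p2 l := sqr_ge0 (p l); have q2 l := sqr_ge0 (q l).
have Ag l : 0 <= (A + 4 * a - g - mu) * p l ^+ 2.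
  by rewrite mulr_ge0 ?p2.
have Bg l : 0 <= (B - g - mu) * q l ^+ 2 by rewrite mulr_ge0 ?q2.
have mup l : (4 * s ^+ 2 * - a + 4 * eta) * p l ^+ 2 <= mu * p l ^+ 2.
  by rewrite ler_wpM2r ?(p2, q2).
have muq l : (4 * s ^+ 2 * - a + 4 * eta) * q l ^+ 2 <= mu * q l ^+ 2.
  by rewrite ler_wpM2r ?(p2, q2).
have ep l : 0 <= eta * p l ^+ 2 by rewrite mulr_ge0 ?(p2, q2).
have eq l : 0 <= eta * q l ^+ 2 by rewrite mulr_ge0 ?(p2, q2).
have sp l : 0 <= s ^+ 2 * - a * p l ^+ 2 by rewrite mulr_ge0 ?(p2, q2).
have sq l : 0 <= s ^+ 2 * - a * q l ^+ 2 by rewrite mulr_ge0 ?(p2, q2).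
have c2E : c ^+ 2 = 1 - s ^+ 2 by rewrite -cs1 addrK.
have atomistic : g * \sum_(2 <= l < K.+1) (p l ^+ 2 + q l ^+ 2) <=
    \sum_(2 <= l < K.+1) V l + \sum_(2 <= l < K.+1) (X (p l) (q l) + X (p l) (q l)).
  rewrite mulr_sumr -big_split /=; apply: ler_sum => l _.
  move: (Ag l) (Bg l) (mup l) (muq l) (ep l) (eq l) (sp l) (sq l).
  by rewrite /V /X c2E; lra.
have continuum : g * \sum_(K.+2 <= l < N.+1) (p l ^+ 2 + q l ^+ 2) <=
    \sum_(K.+2 <= l < N.+1) V l + \sum_(K.+2 <= l < N.+1) (Y l + Y l).
  rewrite mulr_sumr -big_split /=; apply: ler_sum => l _.
  move: (Ag l) (Bg l) (mup l) (muq l) (ep l) (eq l) (sp l) (sq l).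
  by rewrite /V /Y; lra.
(* The telescoped cross term enters the two interface atoms with opposite signs: [d] is [c] at atom
   [1] and [- c] at atom [K.+1]. *)
have interface (d : R) l : d ^+ 2 + s ^+ 2 = 1 -> g * (p l ^+ 2 + q l ^+ 2) <=
    V l + X (p l) (q l) + Y l + 4 * a * d * s * Z l.
  move=> ds1; have := reflection_quad_le (p l) (q l) ds1.
  move=> /(le_trans (ler_norm _)) rf.
  have sa : 0 <= 2 * s * - a by rewrite !mulr_ge0// oppr_ge0.
  have := ler_wpM2l sa rf.
  have : (2 * s * - a + 2 * eta) * (p l ^+ 2 + q l ^+ 2) <= mu * (p l ^+ 2 + q l ^+ 2).
    by rewrite ler_wpM2r// addr_ge0 ?(p2, q2).
  move: (Ag l) (Bg l).
  by rewrite /V /X /Y /Z c2E; lra.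
have first := interface c 1%N cs1.
have last : g * (p K.+1 ^+ 2 + q K.+1 ^+ 2) <=
    V K.+1 + X (p K.+1) (q K.+1) + Y K.+1 + 4 * a * - c * s * Z K.+1.
  by apply: interface; rewrite sqrrN.
(* Periodicity hands the right end of the last local bond to atom [1]. *)
have YN : Y N.+1 = Y 1%N by rewrite /Y pN.
rewrite YN !mulrDr; move: atomistic continuum first last; rewrite /V.
lra.
Qed.

End Stability.

(** * Bounds on the half turning angle and weighted summation of residuals *)

Section Consistency.
Variable R : realType.

Lemma sin_le_id (x : R) : 0 <= x -> sin x <= x.
Proof.
move=> x0.
have [|c _] := @MVT_segment _ (@sin R) (@cos R) 0 x x0 (fun y _ => is_derive_sin y).
  by apply: continuous_subspaceT => y; exact: continuous_sin.
by rewrite sin0 !subr0 => ->; rewrite ler_piMl// cos_le1.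
Qed.

(** More than two atoms put [pi * e] strictly below [pi / 2]; the positive cosine keeps
    next-nearest-neighbour bonds from collapsing. *)
Lemma half_angle_bounds (N : nat) (e := eps R N) : (2 < N)%N ->
  [/\ 0 < e, 0 < cos (pi * e), 0 <= sin (pi * e) & sin (pi * e) <= pi * e].
Proof.
move=> N2; have Npos : 0 < N%:R :> R by rewrite ltr0n (ltn_trans _ N2).
have e0 : 0 < e by rewrite /e /eps invr_gt0.
have th0 : 0 < pi * e :> R by rewrite mulr_gt0// pi_gt0.
have th1 : pi * e < pi / 2 :> R.
  by rewrite ltr_pM2l ?pi_gt0// ltf_pV2 ?posrE// ltr_nat.
split=> //; last exact/sin_le_id/ltW.
  by apply: cos_gt0_pihalf; rewrite th1 andbT (lt_trans _ th0)// oppr_lt0 divr_gt0// pi_gt0.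
by apply/ltW/sin_gt0_pihalf; rewrite th0.
Qed.

(** Cauchy-Schwarz with weight [e] is applied separately to the inner local atoms and to the pair of
    interface atoms; each time the factor in [W] is at most [n]. *)
Lemma weighted_sum_bound (N K : nat) (e al be ka ch n : R)
    (W U1 U2 U3 I : nat -> R) (Pb Qb V1 VK : R) :
  (1 <= K)%N -> (K < N)%N -> 0 <= e -> e * N%:R = 1 ->
  0 <= al -> 0 <= be -> 0 <= ka -> 0 <= ch ->
  n = Num.sqrt (e * \sum_(1 <= l < N.+1) W l ^+ 2) ->
  (forall l, I l <= (al * (U1 l + U2 l + U3 l) + ka) * W l) ->
  Pb <= (be * (U1 K.+1 + VK) + ch) * W K.+1 ->
  Qb <= (be * (U1 1%N + V1) + ch) * W 1%N ->
  e * (Pb + \sum_(K.+2 <= l < N.+1) I l + Qb) <=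
  n * (al * (Num.sqrt (e * \sum_(K.+2 <= l < N.+1) U1 l ^+ 2)
           + Num.sqrt (e * \sum_(K.+2 <= l < N.+1) U2 l ^+ 2)
           + Num.sqrt (e * \sum_(K.+2 <= l < N.+1) U3 l ^+ 2))
     + be * (Num.sqrt (e * U1 1%N ^+ 2 + e * U1 K.+1 ^+ 2)
           + Num.sqrt (e * V1 ^+ 2 + e * VK ^+ 2))
     + (ka + Num.sqrt 2 * Num.sqrt e * ch)).
Proof.
move=> K1 KN e0 eN al0 be0 ka0 ch0 nE Ile Pble Qble.
have n0 : 0 <= n by rewrite nE sqrtr_ge0.
have W2 m k : 0 <= \sum_(m <= l < k) W l ^+ 2 by rewrite sumr_ge0// => i _; exact: sqr_ge0.
have WE := sum_split_interface (fun l => W l ^+ 2) K1 KN.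
have W1 := sqr_ge0 (W 1%N); have WK := sqr_ge0 (W K.+1).
have bulk f : e * \sum_(K.+2 <= l < N.+1) f l * W l <=
    Num.sqrt (e * \sum_(K.+2 <= l < N.+1) f l ^+ 2) * n.
  apply: le_trans (cauchy_schwarz_weighted _ _ _ e0) _.
  rewrite ler_wpM2l ?sqrtr_ge0// nE ler_wsqrtr// ler_wpM2l// WE.
  by rewrite lerDr addr_ge0// addr_ge0.
have pair x y : e * (x * W 1%N + y * W K.+1) <= Num.sqrt (e * x ^+ 2 + e * y ^+ 2) * n.
  have := cauchy_schwarz_weighted [:: (x, W 1%N); (y, W K.+1)] fst snd e0.
  rewrite !big_cons !big_nil /= !addr0 => /le_trans; apply.
  rewrite -mulrDr ler_wpM2l ?sqrtr_ge0// nE ler_wsqrtr// ler_wpM2l// WE.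
  by have := W2 2 K.+1; have := W2 K.+2 N.+1; lra.
have bulk1 : e * \sum_(K.+2 <= l < N.+1) W l <= n.
  have := bulk (fun=> 1); under eq_bigr do rewrite mul1r.
  move/le_trans; apply; rewrite ler_piMl// -[leRHS]sqrtr1 ler_wsqrtr//.
  under eq_bigr do rewrite /= expr1n.
  rewrite sumr_const_nat -[leRHS]eN ler_wpM2l// ler_nat.
  by rewrite subSS leq_subr.
(* The constant 1 on two atoms has squared norm [2 * e]; this gains the extra half power of [e] in
   the interface force error. *)
have pair1 : e * (W 1%N + W K.+1) <= Num.sqrt 2 * Num.sqrt e * n.
  have := pair 1 1; rewrite !mul1r expr1n mulr1 -mulr2n -[e *+ 2]mulr_natl.
  by rewrite sqrtrM.
have Ie : \sum_(K.+2 <= l < N.+1) I l <=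
    al * (\sum_(K.+2 <= l < N.+1) U1 l * W l)
    + al * (\sum_(K.+2 <= l < N.+1) U2 l * W l)
    + al * (\sum_(K.+2 <= l < N.+1) U3 l * W l)
    + ka * (\sum_(K.+2 <= l < N.+1) W l).
  rewrite !mulr_sumr -!big_split /=; apply: ler_sum => l _.
  by apply: le_trans (Ile l) _; rewrite !mulrDr !mulrDl !mulrA.
have h1 := ler_wpM2l al0 (bulk U1); have h2 := ler_wpM2l al0 (bulk U2).
have h3 := ler_wpM2l al0 (bulk U3); have h4 := ler_wpM2l ka0 bulk1.
have h5 := ler_wpM2l be0 (pair (U1 1%N) (U1 K.+1)).
have h6 := ler_wpM2l be0 (pair V1 VK); have h7 := ler_wpM2l ch0 pair1.
have h8 := ler_wpM2l e0 (lerD Pble Qble); have h9 := ler_wpM2l e0 Ie.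
move: h9 h1 h2 h3 h4 h5 h6 h7 h8; lra.
Qed.

End Consistency.

(** * The circular chain and its moving frames *)

Section Chain.
Variable R : realType.
Implicit Types (u v x y : int -> 'rV[R]_2) (l : int).

Definition tangent (alpha : R) : 'rV[R]_2 :=
  \row_(i < 2) (if i == 0 then - sin alpha else cos alpha).

Definition normal (alpha : R) : 'rV[R]_2 :=
  \row_(i < 2) (if i == 0 then - cos alpha else - sin alpha).

(* [T l, V l] is the tangent-normal frame of the bond vector of atom [l], and
   [c, s] are the cosine and sine of half the turning angle, so that
   [c *: T l + s *: V l] is the direction of [y'_(l+1) + y'_l]. *)
Definition turning_frames (N : nat) (c s : R) (T V : int -> 'rV[R]_2) :=
  [/\ forall l, orthoframe (T l) (V l),
      forall l, c *: T (l + 1) - s *: V (l + 1) = c *: T l + s *: V l,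
      forall l, c *: V (l + 1) + s *: T (l + 1) = c *: V l - s *: T l &
      forall l, T (l + N%:Z) = T l /\ V (l + N%:Z) = V l].

(** The chord from atom [l - 1] to atom [l] is parallel to the tangent at the middle angle [al l],
    and the spacing condition makes its scaled length [F]. Consecutive middle angles differ by
    [2 * th]. *)
Lemma circular_config_frames (F : R) (N : nat) (yF : int -> 'rV[R]_2) :
  (0 < N)%N -> circular_config F N yF ->
  exists T V, turning_frames N (cos (pi * eps R N)) (sin (pi * eps R N)) T V /\
    forall l, bdiff N yF l = F *: T l.
Proof.
move=> N0 [r [Q [w [Fr QQ yE]]]].
set th := pi * eps R N in Fr *.
have N0' : N%:R != 0 :> R by rewrite pnatr_eq0 -lt0n.
pose al l : R := 2 * th * l%:~R - th.
have alS l : al (l + 1) = al l + th + th by rewrite /al intrD; ring.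
have alN l : al (l + N%:Z) = al l + pi *+ 2.
  by rewrite /al intrD /th /eps -pmulrn -[pi *+ 2]mulr_natl; field.
exists (fun l => tangent (al l) *m Q), (fun l => normal (al l) *m Q); split; first split.
- have dotQ (x y : 'rV[R]_2) : dot (x *m Q) (y *m Q) = dot x y.
    by rewrite !dot_mulmx trmx_mul mulmxA -(mulmxA x) QQ mulmx1.
  move=> l; have := cos2Dsin2 (al l).
  by split; rewrite dotQ dotE !mxE /=; nra.
- move=> l; rewrite !scalemxAl -mulmxBl -mulmxDl; congr (_ *m Q).
  apply/rowP => i; rewrite !mxE alS.
  have -> : al l = al l + th - th by rewrite addrK.
  by rewrite subrK !(sinD, cosD, sinN, cosN); case: ifP => _; ring.
- move=> l; rewrite !scalemxAl -mulmxBl -mulmxDl; congr (_ *m Q).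
  apply/rowP => i; rewrite !mxE alS.
  have -> : al l = al l + th - th by rewrite addrK.
  by rewrite subrK !(sinD, cosD, sinN, cosN); case: ifP => _; ring.
- by move=> l; rewrite alN /tangent /normal sinD2pi cosD2pi.
move=> l; rewrite /bdiff !yE opprD addrACA subrr addr0 -mulmxBl !scalemxAl.
congr (_ *m Q); apply/rowP => i; rewrite !mxE.
have -> : 2 * pi * eps R N * l%:~R = al l + th by rewrite /al /th; ring.
have -> : 2 * pi * eps R N * (l - 1)%:~R = al l - th.
  by rewrite /al /th intrD; ring.
have e0 : eps R N != 0 by rewrite /eps invr_eq0.
have {Fr} -> : F = 2 * r * sin th / eps R N by rewrite -Fr mulfK.
by case: ifP => _; rewrite !(sinD, cosD, sinN, cosN); field.
Qed.

Lemma bdiff_line (N : nat) y u v (k m : R) l :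
  bdiff N (fun j => y j + k *: u j + m *: v j) l
  = bdiff N y l + k *: bdiff N u l + m *: bdiff N v l.
Proof. by apply/rowP => i; rewrite !mxE; ring. Qed.

Lemma bdiffB (N : nat) u v l : bdiff N (fun j => u j - v j) l = bdiff N u l - bdiff N v l.
Proof. by apply/rowP => i; rewrite !mxE; ring. Qed.

Lemma bdiffE (N : nat) u l : (0 < N)%N -> u l = u (l - 1) + eps R N *: bdiff N u l.
Proof.
move=> N0; rewrite /bdiff scalerA mulfV ?scale1r ?subrKC//.
by rewrite /eps invr_eq0 pnatr_eq0 -lt0n.
Qed.

Lemma bdiff_periodic (N : nat) u : (forall l, u (l + N%:Z) = u l) ->
  forall l, bdiff N u (l + N%:Z) = bdiff N u l.
Proof. by move=> uN l; rewrite /bdiff uN addrAC uN. Qed.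

Lemma has_variationsP (E : (int -> 'rV[R]_2) -> R) y u v (d1 d2 : R) :
  has_variations (fun a b => E (fun j => y j + a *: u j + b *: v j)) d1 d2 ->
  variation1 E y v = d1 /\ variation2 E y u v = d2.
Proof.
move=> /has_variations_derive1[<- <-]; split; last by [].
rewrite /variation1; congr (derive1 _ 0); apply/funext => t; congr E.
by apply/funext => j; rewrite scale0r addr0.
Qed.

(** * Variations of both energies at the circle, coercivity and residuals *)

Section Energies.
Variables (phi : R -> R) (F c s : R) (N K : nat).
Variables (T V : int -> 'rV[R]_2) (yF : int -> 'rV[R]_2).
Hypothesis C3phi : C3_pos phi.
Hypotheses (F0 : 0 < F) (c0 : 0 < c).
Hypothesis cs1 : c ^+ 2 + s ^+ 2 = 1.
Hypothesis frames : turning_frames N c s T V.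
Hypothesis yFE : forall l, bdiff N yF l = F *: T l.

Definition T2 l := c *: T l + s *: V l.
Definition V2 l := c *: V l - s *: T l.

Let F2 := F * c.
Let dphi : R -> R := derive1 phi.
Let ddphi : R -> R := derive1n 2 phi.

Lemma orthoframe2 l : orthoframe (T2 l) (V2 l).
Proof. by apply: orthoframe_rot => //; case: frames. Qed.

(** [T l] and [T (l + 1)] are [T2 l] turned by opposite half angles, so their normal parts cancel in
    the sum. *)
Lemma yF_bond l : bdiff N yF (l + 1) + bdiff N yF l = (2 * F2) *: T2 l.
Proof.
case: frames => _ fT fV _; rewrite !yFE /F2.
have -> : T (l + 1) = c *: T2 l + s *: V2 l.
  rewrite /T2 /V2 -fT -fV -[LHS]scale1r -cs1.
  by apply/rowP => i; rewrite !mxE; ring.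
have -> : T l = c *: T2 l - s *: V2 l.
  rewrite /T2 /V2 -[LHS]scale1r -cs1.
  by apply/rowP => i; rewrite !mxE; ring.
by apply/rowP => i; rewrite !mxE; ring.
Qed.

Definition dE_a v := eps R N * \sum_(1 <= l < N.+1)
  (dphi F * dot (T l%:Z) (bdiff N v l%:Z)
   + dphi (2 * F2) * dot (T2 l%:Z) (bdiff N v (l%:Z + 1) + bdiff N v l%:Z)).

Definition d2E_a u v := eps R N * \sum_(1 <= l < N.+1)
  (qform (ddphi F) (dphi F / F) (T l%:Z) (V l%:Z) (bdiff N u l%:Z) (bdiff N v l%:Z)
   + qform (ddphi (2 * F2)) (dphi (2 * F2) / (2 * F2)) (T2 l%:Z) (V2 l%:Z)
       (bdiff N u (l%:Z + 1) + bdiff N u l%:Z) (bdiff N v (l%:Z + 1) + bdiff N v l%:Z)).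

Lemma pair_variations l u v :
  has_variations (fun a b => phi (enorm (bdiff N (fun j => yF j + a *: u j + b *: v j) l)))
    (dphi F * dot (T l) (bdiff N v l))
    (qform (ddphi F) (dphi F / F) (T l) (V l) (bdiff N u l) (bdiff N v l)).
Proof.
under eq_fun do under eq_fun do rewrite bdiff_line yFE.
by apply: has_variations_pair => //; case: frames.
Qed.

Lemma pair2_variations l u v :
  has_variations (fun a b => phi (enorm (bdiff N (fun j => yF j + a *: u j + b *: v j) (l + 1)
      + bdiff N (fun j => yF j + a *: u j + b *: v j) l)))
    (dphi (2 * F2) * dot (T2 l) (bdiff N v (l + 1) + bdiff N v l))
    (qform (ddphi (2 * F2)) (dphi (2 * F2) / (2 * F2)) (T2 l) (V2 l)
       (bdiff N u (l + 1) + bdiff N u l) (bdiff N v (l + 1) + bdiff N v l)).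
Proof.
have E a b : bdiff N (fun j => yF j + a *: u j + b *: v j) (l + 1)
      + bdiff N (fun j => yF j + a *: u j + b *: v j) l =
    (2 * F2) *: T2 l + a *: (bdiff N u (l + 1) + bdiff N u l)
      + b *: (bdiff N v (l + 1) + bdiff N v l).
  by rewrite /= !bdiff_line -yF_bond; apply/rowP => i; rewrite !mxE; ring.
under eq_fun do under eq_fun do rewrite E.
apply: has_variations_pair => //; last exact: orthoframe2.
by rewrite mulr_gt0 // mulr_gt0.
Qed.

Lemma variations_E_a u v :
  variation1 (E_a phi N) yF v = dE_a v /\ variation2 (E_a phi N) yF u v = d2E_a u v.
Proof.
have h : has_variations (fun a b => E_a phi N (fun j => yF j + a *: u j + b *: v j))
    (dE_a v) (d2E_a u v).
  apply: has_variationsZ; apply: has_variations_sum => l; apply: has_variationsD.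
    exact: pair_variations.
  exact: pair2_variations.
exact: has_variationsP h.
Qed.

Definition dE_qnl v :=
  eps R N * (\sum_(1 <= l < N.+1) dphi F * dot (T l%:Z) (bdiff N v l%:Z))
  + eps R N * (\sum_(1 <= l < K.+1)
      dphi (2 * F2) * dot (T2 l%:Z) (bdiff N v (l%:Z + 1) + bdiff N v l%:Z))
  + eps R N * (\sum_(K.+1 <= l < N.+1) dphi (2 * F) *
      (dot (T l%:Z) (bdiff N v l%:Z) + dot (T (l%:Z + 1)) (bdiff N v (l%:Z + 1)))).

(** The weight 2 in the local part is the factor one half of the energy times the 4 produced by
    doubling both strains. *)
Definition d2E_qnl u v :=
  let H l := qform (ddphi (2 * F)) (dphi (2 * F) / (2 * F)) (T l) (V l)
      (bdiff N u l) (bdiff N v l) in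
  eps R N * (\sum_(1 <= l < N.+1)
     qform (ddphi F) (dphi F / F) (T l%:Z) (V l%:Z) (bdiff N u l%:Z) (bdiff N v l%:Z))
  + eps R N * (\sum_(1 <= l < K.+1)
     qform (ddphi (2 * F2)) (dphi (2 * F2) / (2 * F2)) (T2 l%:Z) (V2 l%:Z)
       (bdiff N u (l%:Z + 1) + bdiff N u l%:Z) (bdiff N v (l%:Z + 1) + bdiff N v l%:Z))
  + eps R N * (\sum_(K.+1 <= l < N.+1) 2 * (H l%:Z + H (l%:Z + 1))).

Lemma local_pair_variations l u v :
  has_variations (fun a b => phi (2 * enorm (bdiff N (fun j => yF j + a *: u j + b *: v j) l)))
    (2 * dphi (2 * F) * dot (T l) (bdiff N v l))
    (4 * qform (ddphi (2 * F)) (dphi (2 * F) / (2 * F)) (T l) (V l) (bdiff N u l) (bdiff N v l)).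
Proof.
have E a b : 2 * enorm (bdiff N (fun j => yF j + a *: u j + b *: v j) l) =
    enorm ((2 * F) *: T l + a *: (2 *: bdiff N u l) + b *: (2 *: bdiff N v l)).
  rewrite bdiff_line yFE -[X in X * _](@gtr0_norm _ 2)// -enormZ; congr enorm.
  by apply/rowP => i; rewrite !mxE; ring.
under eq_fun do under eq_fun do rewrite E.
have -> : 2 * dphi (2 * F) * dot (T l) (bdiff N v l) =
    dphi (2 * F) * dot (T l) (2 *: bdiff N v l) by rewrite dotZr; ring.
have -> : 4 * qform (ddphi (2 * F)) (dphi (2 * F) / (2 * F)) (T l) (V l)
      (bdiff N u l) (bdiff N v l) = qform (ddphi (2 * F)) (dphi (2 * F) / (2 * F)) (T l) (V l)
      (2 *: bdiff N u l) (2 *: bdiff N v l).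
  by rewrite /qform !dotZr; ring.
by apply: has_variations_pair; [|rewrite mulr_gt0|case: frames].
Qed.

Lemma variations_E_qnl u v :
  variation1 (E_qnl phi N K) yF v = dE_qnl v /\
  variation2 (E_qnl phi N K) yF u v = d2E_qnl u v.
Proof.
have h : has_variations (fun a b => E_qnl phi N K (fun j => yF j + a *: u j + b *: v j))
    (dE_qnl v) (d2E_qnl u v).
  apply: has_variationsD; first apply: has_variationsD.
  - by apply: has_variationsZ; apply: has_variations_sum => l; exact: pair_variations.
  - by apply: has_variationsZ; apply: has_variations_sum => l; exact: pair2_variations.
  apply: has_variationsZ; apply: has_variations_sum => l.
  have := has_variationsZ 2^-1 (has_variationsD
    (local_pair_variations l u v) (local_pair_variations (l%:Z + 1) u v)).
  congr has_variations; rewrite ?/H; by field.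
exact: has_variationsP h.
Qed.

(** The frame components [p], [q] of the strain reduce the claim to [chain_stability]. *)
Lemma coercive_E_qnl (gam mu eta : R) u :
  let a := ddphi (2 * F) in let b := dphi (2 * F) / (2 * F) in
  (1 <= K)%N -> (K < N)%N -> (forall l, u (l + N%:Z) = u l) ->
  a <= 0 -> 0 <= b -> 0 <= s ->
  `|ddphi (2 * F2) - a| <= eta -> `|dphi (2 * F2) / (2 * F2) - b| <= eta ->
  gam + mu <= ddphi F + 4 * a -> gam + mu <= dphi F / F ->
  2 * s * - a + 2 * eta <= mu -> 4 * s ^+ 2 * - a + 4 * eta <= mu ->
  gam * inner N (bdiff N u) (bdiff N u) <= d2E_qnl u u.
Proof.
move=> a b K1 KN uN a0 b0 s0 a2a b2b gA gB mu1 mu2.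
case: (frames) => fr fT fV fN.
pose p (l : nat) := dot (T l%:Z) (bdiff N u l%:Z).
pose q (l : nat) := dot (V l%:Z) (bdiff N u l%:Z).
have S1 (l : nat) : l%:Z + 1 = l.+1%:Z by rewrite -addn1 PoszD.
have per (l : int) : [/\ T (l + N%:Z) = T l, V (l + N%:Z) = V l &
    bdiff N u (l + N%:Z) = bdiff N u l].
  by have [-> ->] := fN l; rewrite bdiff_periodic.
have [TN VN dN] := per 1; rewrite addrC S1 in TN VN dN.
have pN : p N.+1 = p 1%N by rewrite /p TN dN.
have qN : q N.+1 = q 1%N by rewrite /q VN dN.
have := chain_stability a0 b0 s0 cs1 a2a b2b gA gB mu1 mu2 K1 KN pN qN.
have e0 : 0 <= eps R N by rewrite /eps invr_ge0 ler0n.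
move=> /(ler_wpM2l e0); congr (_ <= _).
  rewrite /inner mulrCA; congr (_ * (_ * _)); apply: eq_bigr => l _.
  by rewrite (dot_frame _ _ (fr l%:Z)) -!expr2.
rewrite /d2E_qnl !mulrDr; congr (_ + _ + _); congr (_ * _); apply: eq_bigr => l _.
(* Each strain is paired with [T2 l] written in the frame of its own atom; [fT] supplies the
   expression in the frame of [l + 1]. *)
- rewrite /qform; have -> : dot (T2 l%:Z) (bdiff N u (l%:Z + 1) + bdiff N u l%:Z) =
      c * (p l.+1 + p l) - s * (q l.+1 - q l).
    by rewrite dotDr {1}/T2 -fT /T2 !(dotBl, dotDl, dotZl) S1 /p /q; ring.
  have -> : dot (V2 l%:Z) (bdiff N u (l%:Z + 1) + bdiff N u l%:Z) =
      c * (q l.+1 + q l) + s * (p l.+1 - p l).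
    by rewrite dotDr {1}/V2 -fV /V2 !(dotBl, dotDl, dotZl) S1 /p /q; ring.
  by rewrite -!expr2.
- by rewrite /qform S1 /p /q -!expr2.
Qed.

Lemma d2E_qnlBl u u' v :
  d2E_qnl (fun l => u l - u' l) v = d2E_qnl u v - d2E_qnl u' v.
Proof.
have regroup (e x y z x' y' z' : R) : e * x + e * y + e * z
    - (e * x' + e * y' + e * z') = e * (x - x') + e * (y - y') + e * (z - z') by ring.
rewrite /d2E_qnl regroup -!sumrB.
congr (_ * _ + _ * _ + _ * _); apply: eq_bigr => l _.
- by rewrite bdiffB qformBl.
- rewrite -qformBl !bdiffB; congr qform; by rewrite opprD addrACA.
- by rewrite !bdiffB !qformBl; ring.
Qed.

(* The contributions to atom [l] of the bonds to its right and to its left, in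
   the region where the quasi-nonlocal energy uses the local approximation. *)
Definition right_residual u v l :=
  2 * qform (ddphi (2 * F)) (dphi (2 * F) / (2 * F)) (T l) (V l) (bdiff N u l) (bdiff N v l)
  - qform (ddphi (2 * F2)) (dphi (2 * F2) / (2 * F2))
      (c *: T l + s *: V l) (c *: V l - s *: T l)
      (bdiff N u (l + 1) + bdiff N u l) (bdiff N v l)
  + (dphi (2 * F) * dot (T l) (bdiff N v l)
     - dphi (2 * F2) * dot (c *: T l + s *: V l) (bdiff N v l)).

Definition left_residual u v l :=
  2 * qform (ddphi (2 * F)) (dphi (2 * F) / (2 * F)) (T l) (V l) (bdiff N u l) (bdiff N v l)
  - qform (ddphi (2 * F2)) (dphi (2 * F2) / (2 * F2))
      (c *: T l - s *: V l) (c *: V l + s *: T l)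
      (bdiff N u l + bdiff N u (l - 1)) (bdiff N v l)
  + (dphi (2 * F) * dot (T l) (bdiff N v l)
     - dphi (2 * F2) * dot (c *: T l - s *: V l) (bdiff N v l)).

(** Nearest-neighbour terms and the first [K] nonlocal bonds cancel. Each remaining bond is split
    between its two ends, and atom [N.+1] is identified with atom [1]. *)
Lemma energy_jumpE u v : (1 <= K)%N -> (K < N)%N ->
  (forall l, u (l + N%:Z) = u l) -> (forall l, v (l + N%:Z) = v l) ->
  d2E_qnl u v - d2E_a u v + (dE_qnl v - dE_a v) =
  eps R N * (right_residual u v K.+1%:Z
    + \sum_(K.+2 <= l < N.+1) (right_residual u v l%:Z + left_residual u v l%:Z)
    + left_residual u v 1).
Proof.
move=> K1 KN uN vN; case: (frames) => fr fT fV fN.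
have S1 (l : nat) : l%:Z + 1 = l.+1%:Z by rewrite -addn1 PoszD.
have -> : left_residual u v 1 = left_residual u v N.+1%:Z.
  rewrite -S1 addrC /left_residual.
  have [-> ->] := fN 1.
  by rewrite (addrAC 1) !(bdiff_periodic uN) !(bdiff_periodic vN).
rewrite -(sum_shift (fun l : nat => right_residual u v l%:Z)
  (fun l : nat => left_residual u v l%:Z))//.
have key (A B C A' B' C' : nat -> R) (e : R) :
    e * (\sum_(1 <= l < N.+1) A l) + e * (\sum_(1 <= l < K.+1) B l)
      + e * (\sum_(K.+1 <= l < N.+1) C l) - e * (\sum_(1 <= l < N.+1) (A l + B l))
    + (e * (\sum_(1 <= l < N.+1) A' l) + e * (\sum_(1 <= l < K.+1) B' l)
      + e * (\sum_(K.+1 <= l < N.+1) C' l) - e * (\sum_(1 <= l < N.+1) (A' l + B' l)))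
    = e * \sum_(K.+1 <= l < N.+1) ((C l - B l) + (C' l - B' l)).
  have split (f : nat -> R) : \sum_(1 <= l < N.+1) f l =
      \sum_(1 <= l < K.+1) f l + \sum_(K.+1 <= l < N.+1) f l.
    by rewrite (big_cat_nat (n := K.+1))//= ltnW.
  by rewrite !big_split /= !sumrN (split B) (split B'); ring.
apply: etrans (key _ _ _ _ _ _ _) _.
have bond (a b a2 b2 f f2 : R) (t n t' n' tt nn x x' y y' : 'rV[R]_2) :
    2 * (qform a b t n x y + qform a b t' n' x' y') - qform a2 b2 tt nn (x' + x) (y' + y)
    + (f * (dot t y + dot t' y') - f2 * dot tt (y' + y)) =
    2 * qform a b t n x y - qform a2 b2 tt nn (x' + x) y + (f * dot t y - f2 * dot tt y)
    + (2 * qform a b t' n' x' y' - qform a2 b2 tt nn (x' + x) y'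
       + (f * dot t' y' - f2 * dot tt y')).
  by rewrite qformDr dotDr; ring.
congr (_ * _); apply: eq_bigr => l _.
rewrite /right_residual /left_residual -S1 addrK fT fV; exact: bond.
Qed.

Section ResidualBounds.
Variables (eta M : R).
Let a := ddphi (2 * F).
Let b := dphi (2 * F) / (2 * F).
Hypotheses (N0 : (0 < N)%N) (s0 : 0 <= s) (b0 : 0 <= b) (aM : `|a| <= M) (bM : `|b| <= M).
Hypothesis a2a : `|ddphi (2 * F2) - a| <= eta.
Hypothesis b2b : `|dphi (2 * F2) / (2 * F2) - b| <= eta.

Let e := eps R N.
Let e0 : 0 <= e. Proof. by rewrite invr_ge0. Qed.
Let FF0 : 0 < 2 * F. Proof. by rewrite mulr_gt0. Qed.

(** Factoring out [2 * F] rewrites forces through [phi' / r], the quantity whose variation [eta]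
    controls; [c] appears because [F2 = F * c]. *)
Let forceE (x y : R) : dphi (2 * F) * x - dphi (2 * F2) * y =
  2 * F * (b * x - c * (dphi (2 * F2) / (2 * F2)) * y).
Proof. by rewrite /b /F2; field; rewrite !gt_eqF. Qed.

Let force_le (x y : R) : `|x| <= y -> `|2 * F * x| <= 2 * F * y.
Proof. by move=> xy; rewrite normrM (gtr0_norm FF0) ler_wpM2l ?(ltW FF0). Qed.

Lemma right_residual_le u v l :
  right_residual u v l <=
  (2 * (eta + s * `|a - b|) * enorm (bdiff N u l)
   + e * (M + eta) * enorm (bdiff N (bdiff N u) (l + 1))
   + 2 * F * (b * s + eta)) * enorm (bdiff N v l).
Proof.
case: (frames) => /(_ l) fr _ _ _; rewrite /right_residual.
have -> : bdiff N u (l + 1) + bdiff N u l =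
    2 *: bdiff N u l + e *: bdiff N (bdiff N u) (l + 1).
  by rewrite (bdiffE (bdiff N u) (l + 1) N0) addrK addrAC -mulr2n scaler_nat.
rewrite forceE.
apply: le_trans (ler_norm _) _; apply: le_trans (ler_normD _ _) _.
apply: le_trans (lerD (boundary_residual_le fr cs1 a2a b2b _ _ _ e0 aM bM)
  (force_le (boundary_force_le fr cs1 b2b _))) _.
by rewrite (ger0_norm s0) (ger0_norm b0) le_eqVlt; apply/orP; left; apply/eqP; ring.
Qed.

Lemma left_residual_le u v l :
  left_residual u v l <=
  (2 * (eta + s * `|a - b|) * enorm (bdiff N u l)
   + e * (M + eta) * enorm (bdiff N (bdiff N u) l)
   + 2 * F * (b * s + eta)) * enorm (bdiff N v l).
Proof.
case: (frames) => /(_ l) fr _ _ _; rewrite /left_residual.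
have prev : bdiff N u (l - 1) = bdiff N u l - e *: bdiff N (bdiff N u) l.
  by rewrite (bdiffE (bdiff N u) l N0) addrK.
have -> : bdiff N u l + bdiff N u (l - 1) =
    2 *: bdiff N u l + e *: - bdiff N (bdiff N u) l.
  by rewrite prev scalerN addrA -mulr2n scaler_nat.
(* The left bond is the mirror image of the right one: [s] and the increment of the strain change
   sign. *)
have cs1' : c ^+ 2 + (- s) ^+ 2 = 1 by rewrite sqrrN.
rewrite forceE -[- (s *: V l)]scaleNr.
rewrite -[s *: T l]opprK -[- (s *: T l)]scaleNr.
apply: le_trans (ler_norm _) _; apply: le_trans (ler_normD _ _) _.
apply: le_trans (lerD (boundary_residual_le fr cs1' a2a b2b _ _ _ e0 aM bM)
  (force_le (boundary_force_le fr cs1' b2b _))) _.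
rewrite enormN normrN (ger0_norm s0) (ger0_norm b0).
by rewrite le_eqVlt; apply/orP; left; apply/eqP; ring.
Qed.

Lemma interior_residual_sum_le u v l :
  right_residual u v l + left_residual u v l <=
  (4 * (eta + s ^+ 2 * `|a - b|) * enorm (bdiff N u l)
   + 2 * e * s * (`|a - b| + 2 * eta) * enorm (bdiff N (bdiff N u) l)
   + e ^+ 2 * (M + eta) * enorm (bdiff N (bdiff N (bdiff N u)) (l + 1))
   + 4 * F * (s ^+ 2 * b + eta)) * enorm (bdiff N v l).
Proof.
case: (frames) => /(_ l) fr _ _ _; rewrite /right_residual /left_residual.
(* Both neighbours are expanded around [l] with the same second difference, the one at [l]; this
   shifts the third difference to [l + 1]. *)
have -> : bdiff N u (l + 1) + bdiff N u l = 2 *: bdiff N u l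
    + e *: (bdiff N (bdiff N u) l + e *: bdiff N (bdiff N (bdiff N u)) (l + 1)).
  rewrite (bdiffE (bdiff N u) (l + 1) N0) (bdiffE (bdiff N (bdiff N u)) (l + 1) N0) !addrK.
  by rewrite addrAC -mulr2n scaler_nat.
have prev : bdiff N u (l - 1) = bdiff N u l - e *: bdiff N (bdiff N u) l.
  by rewrite (bdiffE (bdiff N u) l N0) addrK.
have -> : bdiff N u l + bdiff N u (l - 1) = 2 *: bdiff N u l - e *: bdiff N (bdiff N u) l.
  by rewrite prev addrA -mulr2n scaler_nat.
have regroup (h g g' r x y y' : R) :
    2 * h - g + 2 * F * (b * x - r * y) + (2 * h - g' + 2 * F * (b * x - r * y')) =
    (4 * h - g - g') + 2 * F * (2 * b * x - r * y - r * y') by ring.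
rewrite !forceE regroup.
apply: le_trans (ler_norm _) _; apply: le_trans (ler_normD _ _) _.
apply: le_trans (lerD (interior_residual_le fr cs1 a2a b2b _ _ _ _ e0 aM bM)
  (force_le (interior_force_le fr cs1 b2b _))) _.
by rewrite (ger0_norm s0) (ger0_norm b0) le_eqVlt; apply/orP; left; apply/eqP; ring.
Qed.

End ResidualBounds.

End Energies.
End Chain.

(** * Residual coefficients compared with the constants of the estimate *)

Section Constants.
Variables (R : realType) (a k Cphi e s F : R).
Hypotheses (e0 : 0 < e) (s0 : 0 <= s) (sth : s <= pi * e).
Hypotheses (k0 : 0 <= k) (Cphi0 : 0 < Cphi) (F0 : 0 < F).

Let M := Num.max `|a| `|k|.
Let eta := Cphi * e ^+ 2.

Let D0 : 0 <= `|a - k|. Proof. exact: normr_ge0. Qed.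
Let s2le : s ^+ 2 <= (pi * e) ^+ 2.
Proof. by rewrite lerXn2r ?nnegrE// mulr_ge0 ?pi_ge0 ?ltW. Qed.
Let pi2 : 2 <= pi :> R. Proof. exact: pi_ge2. Qed.

(** With [s <= pi * e] the second-difference coefficient is at most [2 * pi * |a - k| * e ^+ 2 + 4 *
    pi * Cphi * e ^+ 4]: its last term is the source of [C2], and [2 <= pi] puts the first below the
    [pi ^+ 2] term of [C1]. *)
Lemma bulk_constants
    (C1 := Num.max M (4 * pi ^+ 2 * `|a - k| + 12 * Cphi)) (C2 := 4 * pi * Cphi)
    (al := C1 * e ^+ 2 + C2 * e ^+ 4) :
  [/\ 0 <= al, 4 * (eta + s ^+ 2 * `|a - k|) <= al,
      2 * e * s * (`|a - k| + 2 * eta) <= al & e ^+ 2 * (M + eta) <= al].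
Proof.
have C1M : M <= C1 by rewrite le_max lexx.
have C1D : 4 * pi ^+ 2 * `|a - k| + 12 * Cphi <= C1 by rewrite le_max lexx orbT.
have M0 : 0 <= M by rewrite le_max normr_ge0.
have e2 : 0 < e ^+ 2 by rewrite exprn_gt0.
have e4 : 0 < e ^+ 4 by rewrite exprn_gt0.
have eta0 : 0 < eta by rewrite mulr_gt0.
have Ce4 : 0 < Cphi * e ^+ 4 by rewrite mulr_gt0.
have piC : 2 * (Cphi * e ^+ 4) <= pi * (Cphi * e ^+ 4) by rewrite ler_wpM2r// ltW.
have h1 := ler_wpM2l (ltW e2) C1M; have h2 := ler_wpM2l (ltW e2) C1D.
have h3 := ler_wpM2r D0 s2le.
have D2e : 0 <= `|a - k| * e ^+ 2 by rewrite mulr_ge0// ltW.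
have h4 : 2 * pi * (`|a - k| * e ^+ 2) <= pi ^+ 2 * (`|a - k| * e ^+ 2).
  by rewrite ler_wpM2r// expr2 ler_wpM2r// pi_ge0.
have h5 : 0 <= pi ^+ 2 * (`|a - k| * e ^+ 2) by rewrite mulr_ge0 ?sqr_ge0.
have h6 : e * s * (`|a - k| + 2 * eta) <= e * (pi * e) * (`|a - k| + 2 * eta).
  by rewrite ler_wpM2r ?ler_wpM2l ?addr_ge0 ?mulr_ge0// ltW.
have h7 := mulr_ge0 M0 (ltW e2).
rewrite /al /C2 /eta in h6 *; split.
- by move: h1 h7 Ce4 piC; lra.
- by move: h2 h3 Ce4 piC eta0; rewrite /eta; lra.
- by move: h2 h4 h5 h6 Ce4 piC eta0; rewrite /eta; lra.
- by move: h1 Ce4 piC; lra.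
Qed.

Lemma interface_constants (C3 := Num.max M (2 * pi * `|a - k|))
    (be := C3 * e + 6 * Cphi * e ^+ 2 + Cphi * e ^+ 3) :
  [/\ 0 <= be, 2 * (eta + s * `|a - k|) <= be & e * (M + eta) <= be].
Proof.
have C3M : M <= C3 by rewrite le_max lexx.
have C3D : 2 * pi * `|a - k| <= C3 by rewrite le_max lexx orbT.
have M0 : 0 <= M by rewrite le_max normr_ge0.
have eta0 : 0 < Cphi * e ^+ 2 by rewrite mulr_gt0 ?exprn_gt0.
have eta1 : 0 < Cphi * e ^+ 3 by rewrite mulr_gt0 ?exprn_gt0.
have h1 := ler_wpM2l (ltW e0) C3M; have h2 := ler_wpM2l (ltW e0) C3D.
have h3 := ler_wpM2r D0 sth; have h4 := mulr_ge0 M0 (ltW e0).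
rewrite /be /eta; split.
- by move: h1 h4 eta0 eta1; lra.
- by move: h2 h3 eta0 eta1; lra.
- by move: h1 eta0 eta1; lra.
Qed.

Lemma force_constants (f := 2 * F * k) :
  [/\ 4 * F * (s ^+ 2 * k + eta)
        <= (4 * Cphi * (1 + pi ^+ 2 * e ^+ 2) * F + 2 * pi ^+ 2 * `|f|) * e ^+ 2 &
      2 * F * (k * s + eta) <= (2 * e * Cphi * (1 + pi * e) * F + pi * `|f|) * e].
Proof.
have Fk : 0 <= F * k by rewrite mulr_ge0// ltW.
have -> : `|f| = 2 * (F * k) by rewrite /f -mulrA ger0_norm// mulr_ge0.
have h1 := ler_wpM2l Fk s2le; have h2 := ler_wpM2l Fk sth.
have h3 : 0 <= Cphi * F * (pi ^+ 2 * e ^+ 4).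
  exact: mulr_ge0 (mulr_ge0 (ltW Cphi0) (ltW F0)) (mulr_ge0 (sqr_ge0 _) (exprn_ge0 4 (ltW e0))).
have h4 : 0 <= Cphi * F * (pi * e ^+ 3).
  exact: mulr_ge0 (mulr_ge0 (ltW Cphi0) (ltW F0)) (mulr_ge0 (pi_ge0 _) (exprn_ge0 3 (ltW e0))).
by rewrite /eta; split; [move: h1 h3|move: h2 h4]; lra.
Qed.

End Constants.

(** * Assembly of coercivity and consistency *)

Lemma le_of_coercive_le (R : realType) (g n a A b B C : R) : 0 < g -> 0 <= n ->
  0 <= a * A + b * B + C -> g * n ^+ 2 <= n * (a * A + b * B + C) ->
  n <= g^-1 * a * A + g^-1 * b * B + g^-1 * C.
Proof.
move=> g0 n0 S0; rewrite -!(mulrA g^-1) -!mulrDr ler_pdivlMl//.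
have [->|nn0] := eqVneq n 0; first by rewrite mulr0.
have np : 0 < n by rewrite lt_neqAle eq_sym nn0.
by rewrite expr2 mulrCA ler_pM2l.
Qed.

Theorem theorem10p9 (R : realType) (phi : R -> R) (F Cphi : R) (N K : nat)
    (yF f ua uq : int -> 'rV[R]_2) :
  let e := eps R N in
  let F2 := F * cos (pi * e) in
  let dphi : R -> R := derive1 phi in
  let ddphi : R -> R := derive1n 2 phi in
  let gamma4 := Num.min (ddphi F + 4 * ddphi (2 * F)) (dphi F / F) in
  let gammae :=
    gamma4 - e * Num.max (2 * pi * `|ddphi (2 * F)| + 2 * e * Cphi)
                         (4 * e * (pi ^+ 2 * `|ddphi (2 * F)| + Cphi)) in
  let k := dphi (2 * F) / (2 * F) in
  let C1 := Num.max (Num.max `|ddphi (2 * F)| `|k|)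
                    (4 * pi ^+ 2 * `|ddphi (2 * F) - k| + 12 * Cphi) in
  let C2 := 4 * pi * Cphi in
  let C3 := Num.max (Num.max `|ddphi (2 * F)| `|k|)
                    (2 * pi * `|ddphi (2 * F) - k|) in
  let Ckappa := 4 * Cphi * (1 + pi ^+ 2 * e ^+ 2) * F
                + 2 * pi ^+ 2 * `|dphi (2 * F)| in
  let CI := Num.sqrt 2 * (2 * e * Cphi * (1 + pi * e) * F
                          + pi * `|dphi (2 * F)|) in
  let d1 := bdiff N ua in
  let d2 := bdiff N d1 in
  let d3 := bdiff N d2 in
  0 < F ->
  (1 < K)%N -> (K < N)%N ->
  circular_config F N yF ->
  0 < Cphi ->
  Num.max `|ddphi (2 * F2) - ddphi (2 * F)|
          `|dphi (2 * F2) / (2 * F2) - dphi (2 * F) / (2 * F)|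
    <= Cphi * e ^+ 2 ->
  in_U N f -> in_U N ua -> in_U N uq ->
  (forall v, in_U N v ->
     variation1 (E_a phi N) yF v + variation2 (E_a phi N) yF ua v
     = inner N f v) ->
  (forall v, in_U N v ->
     variation1 (E_qnl phi N K) yF v + variation2 (E_qnl phi N K) yF uq v
     = inner N f v) ->
  C3_pos phi ->
  0 <= dphi (2 * F) ->
  ddphi (2 * F) <= 0 ->
  0 < gamma4 ->
  0 < gammae ->
  l2norm N (bdiff N (fun l => ua l - uq l))
  <= gammae^-1 * (C1 * e ^+ 2 + C2 * e ^+ 4)
       * (Num.sqrt (e * \sum_(K.+2 <= l < N.+1) enorm (d1 l%:Z) ^+ 2)
          + Num.sqrt (e * \sum_(K.+2 <= l < N.+1) enorm (d2 l%:Z) ^+ 2)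
          + Num.sqrt (e * \sum_(K.+2 <= l < N.+1) enorm (d3 (l%:Z + 1)) ^+ 2))
   + gammae^-1 * (C3 * e + 6 * Cphi * e ^+ 2 + Cphi * e ^+ 3)
       * (Num.sqrt (e * enorm (d1 1) ^+ 2 + e * enorm (d1 K.+1%:Z) ^+ 2)
          + Num.sqrt (e * enorm (d2 1) ^+ 2 + e * enorm (d2 K.+2%:Z) ^+ 2))
   + gammae^-1 * (Ckappa * e ^+ 2 + CI * e `^ (3 / 2)).

Proof.
move=> e F2 dphi ddphi gamma4 gammae k C1 C2 C3 Ckappa CI d1 d2 d3 F0 K1 KN circ Cphi0.
rewrite ge_max => /andP[a2a b2b] fU [uaN uaS] [uqN uqS] eqa eqq C3phi f20 a0 _ gam0.
have N2 : (2 < N)%N by exact: leq_ltn_trans K1 KN.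
have N0 : (0 < N)%N by exact: ltn_trans N2.
have [e0 c0 s0 sth] := half_angle_bounds R N2.
have [T [V [frames yFE]]] := circular_config_frames N0 circ.
rewrite -/e in e0 c0 s0 sth frames.
set c := cos (pi * e) in c0 frames F2 a2a b2b; set s := sin (pi * e) in s0 sth frames.
have cs1 : c ^+ 2 + s ^+ 2 = 1 by exact: cos2Dsin2.
pose w l := ua l - uq l.
have wN l : w (l + N%:Z) = w l by rewrite /w uaN uqN.
have wU : in_U N w by split=> //; rewrite sumrB uaS uqS subrr.
have k0 : 0 <= k by rewrite divr_ge0// mulr_ge0// ltW.
have K1' : (1 <= K)%N by exact: ltnW.
have [va1 va2] := variations_E_a C3phi F0 c0 cs1 frames yFE ua w.
have [vq1 vq2] := variations_E_qnl K C3phi F0 c0 cs1 frames yFE uq w.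
have ea := eqa w wU; have eq := eqq w wU.
rewrite va1 va2 in ea; rewrite vq1 vq2 in eq.
pose M := Num.max `|ddphi (2 * F)| `|k|.
pose eta := Cphi * e ^+ 2.
have aM : `|ddphi (2 * F)| <= M by rewrite le_max lexx.
have kM : `|k| <= M by rewrite le_max lexx orbT.
(* The stability loss: [gammae + mu] is [gamma4], a minimum, hence below both of its arguments. *)
pose mu := gamma4 - gammae.
have muE : mu = e * Num.max (2 * pi * `|ddphi (2 * F)| + 2 * e * Cphi)
    (4 * e * (pi ^+ 2 * `|ddphi (2 * F)| + Cphi)) by rewrite /mu /gammae subKr.
have na0 : `|ddphi (2 * F)| = - ddphi (2 * F) by exact: ler0_norm.
have coercive : gammae * inner N (bdiff N w) (bdiff N w) <= d2E_qnl phi F c s N K T V w w.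
  apply: (coercive_E_qnl cs1 frames (mu := mu) (eta := eta)) => //.
  - by rewrite /mu subrKC ge_min lexx.
  - by rewrite /mu subrKC ge_min lexx orbT.
  - rewrite -na0 muE; apply: le_trans (_ : _ <= e * (2 * pi * `|ddphi (2 * F)| + 2 * e * Cphi)) _.
      have := ler_wpM2r (normr_ge0 (ddphi (2 * F))) sth; rewrite /eta.
      by move: `|_| => A; clear; lra.
    by rewrite ler_wpM2l ?(ltW e0)// le_max lexx.
  - rewrite -na0 muE.
    apply: le_trans (_ : _ <= e * (4 * e * (pi ^+ 2 * `|ddphi (2 * F)| + Cphi))) _.
      have s2 : s ^+ 2 <= (pi * e) ^+ 2.
        by rewrite lerXn2r ?nnegrE// mulr_ge0 ?pi_ge0 ?ltW.
      have := ler_wpM2r (normr_ge0 (ddphi (2 * F))) s2; rewrite /eta.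
      by move: `|_| => A; clear; lra.
    by rewrite ler_wpM2l ?(ltW e0)// le_max lexx orbT.
(* Both equations tested with [w] have the right-hand side [inner N f w], which is eliminated. *)
have jump : d2E_qnl phi F c s N K T V w w =
    d2E_qnl phi F c s N K T V ua w - d2E_a phi F c s N T V ua w
    + (dE_qnl phi F c s N K T V w - dE_a phi F c s N T V w).
  have sub (x y z x' y' r : R) : x + y = r -> z + x' = r -> y' - x' = y' - y + (z - x).
    by clear; lra.
  by rewrite d2E_qnlBl; exact: sub ea eq.
pose al := C1 * e ^+ 2 + C2 * e ^+ 4.
pose be := C3 * e + 6 * Cphi * e ^+ 2 + Cphi * e ^+ 3.
pose X := 2 * e * Cphi * (1 + pi * e) * F + pi * `|dphi (2 * F)|.
have fE : dphi (2 * F) = 2 * F * k by rewrite /k mulrCA mulfV ?mulr1// gt_eqF// mulr_gt0.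
have [al0 al1 al2 al3] := bulk_constants (ddphi (2 * F)) k e0 s0 sth Cphi0.
have [be0 be1 be2] := interface_constants (ddphi (2 * F)) k e0 sth Cphi0.
have [ka1 ch1] := force_constants e0 s0 sth k0 Cphi0 F0.
rewrite -fE in ka1 ch1.
have ka0 : 0 <= Ckappa * e ^+ 2.
  apply: le_trans (ka1); apply: mulr_ge0; first by rewrite mulr_ge0// ltW.
  exact: addr_ge0 (mulr_ge0 (sqr_ge0 s) k0) (mulr_ge0 (ltW Cphi0) (sqr_ge0 e)).
have ch0 : 0 <= X * e.
  apply: le_trans (ch1); apply: mulr_ge0; first by rewrite mulr_ge0// ltW.
  exact: addr_ge0 (mulr_ge0 k0 s0) (mulr_ge0 (ltW Cphi0) (sqr_ge0 e)).
pose n := l2norm N (bdiff N w).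
have n0 : 0 <= n by exact: sqrtr_ge0.
have dd l : dot (bdiff N w l) (bdiff N w l) = enorm (bdiff N w l) ^+ 2 by rewrite sqr_enorm.
have nE : n = Num.sqrt (e * \sum_(1 <= l < N.+1) enorm (bdiff N w l%:Z) ^+ 2).
  by rewrite /n /l2norm /inner; under eq_bigr do rewrite dd.
have n2 : n ^+ 2 = inner N (bdiff N w) (bdiff N w).
  rewrite /n sqr_sqrtr// mulr_ge0 ?(ltW e0)// sumr_ge0// => l _.
  exact: dotxx_ge0.
have eN : e * N%:R = 1 by rewrite /e /eps mulVf// pnatr_eq0 -lt0n.
rewrite -n2 jump (energy_jumpE phi F frames K1' KN uaN wN) in coercive.
have W0 l : 0 <= enorm (bdiff N w l) by exact: enorm_ge0.
have R0 l : right_residual phi F c s N T V ua w l + left_residual phi F c s N T V ua w l <=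
   (al * (enorm (d1 l) + enorm (d2 l) + enorm (d3 (l + 1))) + Ckappa * e ^+ 2)
     * enorm (bdiff N w l).
  apply: le_trans (interior_residual_sum_le F0 c0 cs1 frames N0 s0 k0 aM kM a2a b2b ua w l) _.
  rewrite ler_wpM2r// (mulrDr al) (mulrDr al); apply: lerD; last exact: ka1.
  by apply: lerD; first apply: lerD; rewrite ler_wpM2r ?enorm_ge0.
(* The right residual at atom [K.+1] involves the second difference one atom further, at [K.+2]; the
   left residual at atom [1] involves the one at [1] itself. *)
have KS : K.+1%:Z + 1 = K.+2%:Z by rewrite -[in RHS]addn1 PoszD.
have rres : right_residual phi F c s N T V ua w K.+1%:Z <=
    (be * (enorm (d1 K.+1%:Z) + enorm (d2 K.+2%:Z)) + X * e) * enorm (bdiff N w K.+1%:Z).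
  rewrite -KS.
  apply: le_trans (right_residual_le F0 c0 cs1 frames N0 s0 k0 aM kM a2a b2b ua w _) _.
  rewrite ler_wpM2r// (mulrDr be); apply: lerD; last exact: ch1.
  by apply: lerD; rewrite ler_wpM2r ?enorm_ge0.
have lres : left_residual phi F c s N T V ua w 1 <=
    (be * (enorm (d1 1) + enorm (d2 1)) + X * e) * enorm (bdiff N w 1).
  apply: le_trans (left_residual_le F0 c0 cs1 frames N0 s0 k0 aM kM a2a b2b ua w 1) _.
  rewrite ler_wpM2r// (mulrDr be); apply: lerD; last exact: ch1.
  by apply: lerD; rewrite ler_wpM2r ?enorm_ge0.
have := weighted_sum_bound (U1 := fun l : nat => enorm (d1 l%:Z))
  (U2 := fun l : nat => enorm (d2 l%:Z)) (U3 := fun l : nat => enorm (d3 (l%:Z + 1)))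
  K1' KN (ltW e0) eN al0 be0 ka0 ch0 nE (fun l : nat => R0 l%:Z) rres lres.
move=> /(le_trans coercive).
(* One power of [e] comes from the interface force residual, the half power from the weight of two
   atoms. *)
have -> : Num.sqrt 2 * Num.sqrt e * (X * e) = CI * e `^ (3 / 2).
  have -> : (3 / 2 : R) = 1 + 2^-1 by field.
  rewrite powRD; last by rewrite gt_eqF// implybT.
  rewrite powRr1 ?(ltW e0)// powR12_sqrt ?(ltW e0)// /CI -/X.
  by clear; ring.
have CI0 : 0 <= CI by rewrite mulr_ge0 ?sqrtr_ge0// -(pmulr_lge0 _ e0).
apply: le_of_coercive_le => //.
exact: addr_ge0 (addr_ge0
  (mulr_ge0 al0 (addr_ge0 (addr_ge0 (sqrtr_ge0 _) (sqrtr_ge0 _)) (sqrtr_ge0 _)))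
  (mulr_ge0 be0 (addr_ge0 (sqrtr_ge0 _) (sqrtr_ge0 _))))
  (addr_ge0 ka0 (mulr_ge0 CI0 (powR_ge0 _ _))).
Qed.
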